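(* Let $S\subseteq\mathbb{R}^n$ be compact and Zariski dense, and let $\Phi\colon\mathbb{R}[X_1,\ldots,X_n]\to\mathbb{R}[X_1,\ldots,X_n]$ be an $S$-nonnegativity preserver. Then the following are equivalent: (i) There is some $d\in\mathbb{N}$ such that all the functions $\Phi^*_A$ ($A\subseteq S$ Borel) are polynomials of degree $\le d$ (as functions on $S$). (ii) $\Phi$ has finite dimensional range. (iii) $\widetilde{\Phi}$ has finite dimensional range.
   Context: A linear map $\Phi$ on $\mathbb{R}[X_1,\ldots,X_n]$ is an $S$-nonnegativity preserver if $p\ge0$ on $S$ implies $\Phi(p)\ge 0$ on $S$ for all polynomials $p$. $S$ is Zariski dense if it is not contained in the zero set of a nonzero polynomial. For compact $S$ and each $x\in S$ there is a unique nonnegative Borel measure $\mu_x$ on $S$ with $\Phi(p)(x)=\int_S p\,d\mu_x$ for all polynomials $p$. For a Borel set $A\subseteq S$ define $\Phi^*_A\colon S\to[0,\infty)$, $x\mapsto\mu_x(A)$. $\mathbb{R}[X_1,\ldots,X_n]$ is normed by $\|p\|_\infty=\max_{x\in S}|p(x)|$; every $S$-nonnegativity preserver is continuous for this norm, and $\mathbb{R}[X_1,\ldots,X_n]$ embeds densely into the Banach space $C(S)$ of continuous real valued functions on $S$ with the sup-norm. $\widetilde{\Phi}\colon C(S)\to C(S)$ denotes the unique continuous linear extension of $\Phi$. *)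

(* Defs.v *)
From HB Require Import structures.
From mathcomp Require Import all_boot all_order all_algebra.
From mathcomp Require Import all_classical all_reals all_analysis.
From mathcomp Require mpoly.
(* The notations of mpoly clash with those of mathcomp-analysis. *)
Export -(notations) mpoly.

Set Implicit Arguments.
Unset Strict Implicit.
Unset Printing Implicit Defensive.

Import Order.TTheory GRing.Theory Num.Theory.
Import numFieldNormedType.Exports.

Local Open Scope classical_set_scope.
Local Open Scope ring_scope.

Definition the_such {T : Type} (x0 : T) (P : set T) : T :=
  if pselect (exists x, P x) is left ex then sval (cid ex) else x0.

Definition finite_dim {R : realType} {V : lmodType R} (A : set V) : Prop :=
  exists (m : nat) (b : 'I_m -> V),
    A = [set v | exists c : 'I_m -> R, v = \sum_(i < m) c i *: b i].

Section Polynomials.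
Context {R : realType} {n : nat}.
Implicit Types (p : mpoly n R) (S : set 'rV[R]_n).

Definition evalp p (x : 'rV[R]_n) : R := meval (fun i => x ord0 i) p.

(* [mmeasure mdeg] is [msize]: one plus the total degree, and 0 for p = 0. *)
Definition deg_le (d : nat) p : Prop := (mmeasure mdeg p <= d.+1)%N.

Definition zariski_dense S : Prop :=
  ~ exists2 p : mpoly n R, p != 0 & S `<=` [set x | evalp p x = 0].

Definition nonneg_preserver S (Phi : mpoly n R -> mpoly n R) : Prop :=
  forall p, (forall x, S x -> 0 <= evalp p x) ->
            forall x, S x -> 0 <= evalp (Phi p) x.

Definition restrp S p : S -> R := fun x => evalp p (set_val x).

Lemma evalp_continuous p : continuous (evalp p).
Proof.
have -> : evalp p = fun x : 'rV[R]_n =>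
    \sum_(m <- msupp p) mcoeff m p * \prod_(i < n) x ord0 i ^+ m i.
  by apply/funext => x; rewrite /evalp mevalE.
apply: continuous_big => [|m _ x]; first exact: add_continuous.
apply: (@continuousM _ _ (fun=> mcoeff m p)
  (fun x : 'rV[R]_n => \prod_(i < n) x ord0 i ^+ m i)).
  exact: cst_continuous.
move: x; apply: continuous_big => [|i _ x]; first exact: mul_continuous.
apply: (@continuous_comp _ _ _ (fun y : 'rV[R]_n => y ord0 i)
  (fun r : R => r ^+ m i)).
  exact: coord_continuous.
exact: exprn_continuous.
Qed.

Lemma restrp_continuous S p : continuous (restrp (S := S) p).
Proof.
move=> x; apply: continuous_comp; last exact: evalp_continuous.
exact: initial_continuous.
Qed.

End Polynomials.

Arguments restrp {R n} S p.

(* The space C(S) of continuous functions on S; here S, coerced to a type, *)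
(* carries the topology induced by R^n.                                    *)
Section ContinuousFunctions.
Context {R : realType} {n : nat} (S : set 'rV[R]_n).

Definition continuous_pred : {pred S -> R} := fun f => `[< continuous f >].

Lemma continuous_pred_submod : submod_closed continuous_pred.
Proof.
split=> [|a f g /asboolP cf /asboolP cg]; apply/asboolP => x.
  exact: (@cst_continuous S R 0).
apply: (@continuousD _ _ _ (fun y => a * f y) g); last exact: cg.
by apply: (@continuousM _ _ (fun=> a) f); [exact: cst_continuous | exact: cf].
Qed.

HB.instance Definition _ :=
  GRing.isSubmodClosed.Build R (S -> R) continuous_pred continuous_pred_submod.

Definition contS := {f : S -> R | f \in continuous_pred}.

HB.instance Definition _ := SubChoice.on contS.
HB.instance Definition _ := [SubChoice_isSubLmodule of contS by <:].

Definition polyS (p : mpoly n R) : contS :=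
  exist _ (restrp S p) (asboolT (@restrp_continuous R n S p)).

Definition supnorm (f : contS) : R := sup (range (fun x : S => `|val f x|)).

Definition supnorm_continuous (T : contS -> contS) : Prop :=
  forall f (e : R), 0 < e -> exists2 d : R, 0 < d &
    forall g, supnorm (g - f) < d -> supnorm (T g - T f) < e.

(* For compact S and a nonnegativity preserver Phi, there is exactly one such *)
(* extension, so that the default value 0 is irrelevant.                      *)
Definition extend_to_contS (Phi : mpoly n R -> mpoly n R) : contS -> contS :=
  the_such (fun=> 0)
    [set T | [/\ linear T, supnorm_continuous T &
                 forall p, T (polyS p) = polyS (Phi p)]].

End ContinuousFunctions.

Section RepresentingMeasures.
Context {R : realType} {n : nat} (S : set 'rV[R]_n).
Variable Phi : mpoly n R -> mpoly n R.

Definition borel_space := g_sigma_algebraType (@open 'rV[R]_n).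

(* A Borel measure on the Borel set S is encoded as a Borel measure on R^n *)
(* that vanishes on the complement of S.                                   *)
Definition represents (x : S) (mu : {measure set borel_space -> \bar R}) :=
  mu (~` S) = 0%E /\
  forall p : mpoly n R, (evalp (Phi p) (set_val x))%:E =
    (\int[mu]_(y in (S : set borel_space)) (evalp p y)%:E)%E.

(* For compact S and a nonnegativity preserver Phi, exactly one measure     *)
(* represents each x, so that the default value is irrelevant.              *)
Definition repr_measure (x : S) : {measure set borel_space -> \bar R} :=
  @the_such {measure set borel_space -> \bar R} mzero [set mu | represents x mu].

(* The representing measures are finite: mu_x(S) = Phi(1)(x). *)
Definition Phistar (A : set borel_space) : S -> R :=
  fun x => fine (repr_measure x A).

End RepresentingMeasures.

Arguments contS {R n} S.
Arguments extend_to_contS {R n} S Phi.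
Arguments represents {R n} S Phi x mu.
Arguments repr_measure {R n} S Phi x.
Arguments Phistar {R n} S Phi A.

(* Main.v *)
(* A positive linear functional on C(S) is integration against a Borel        *)
(* measure, so each functional p |-> Phi p (x) is represented by mu_x. If W   *)
(* is a finite-dimensional space of polynomials then, S being Zariski dense,  *)
(* there are nodes x_1, ..., x_k in S and c_1, ..., c_k in W such that        *)
(* q = sum_j q(x_j) c_j for all q in W. By the density of the polynomials in  *)
(* C(S) and the uniqueness of representing measures, the following are        *)
(* equivalent for fixed nodes x_j and polynomials c_j:                        *)
(*   Phi p (s) = sum_j c_j(s) Phi p (x_j) for all p,                          *)
(*   mu_s = sum_j c_j(s) mu_(x_j),                                            *)
(* and both imply T f (s) = sum_j c_j(s) T f (x_j) for the extension T of Phi *)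
(* to C(S). With W the polynomials of degree at most d, (i) gives the second  *)
(* identity; with W the range of Phi, (ii) gives the first.                   *)

Require Import Defs.
From HB Require Import structures.
From mathcomp Require Import all_boot all_order all_algebra.
From mathcomp Require Import all_classical all_reals all_analysis.
From mathcomp Require Import measurable_realfun ring lra.

Set Implicit Arguments.
Unset Strict Implicit.
Unset Printing Implicit Defensive.

Import Order.TTheory GRing.Theory Num.Theory.
Import numFieldNormedType.Exports.

Local Open Scope classical_set_scope.
Local Open Scope ring_scope.

(** * Finite-dimensional spaces of polynomials *)

(** The heart is a finite reproducing formula. A finite-dimensional space of polynomials has nodes
    in [S] and coefficient polynomials that recover each member from its values at the nodes
    ([interpolation]). By [Phistar_interpolation], such a formula at a point [s] holds for every
    [Phi p] exactly when it holds for every [Phistar S Phi A]: one direction integrates, the other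
    is the uniqueness of representing measures. Used with the polynomials of degree at most [d], it
    puts the range of [Phi] in the span of the coefficient polynomials. Used with the range of
    [Phi], it writes each [Phistar S Phi A] as a combination of them, so the degree bound does not
    depend on [A].

    The formula passes to the extension by density and continuity ([finite_dim_extend]). Conversely,
    the extension acts as [Phi] on polynomials, and Zariski density makes restriction to [S]
    injective ([extend_finite_dim]).

    The remaining work shows that the objects exist: [stone_weierstrass] gives density, [extension]
    carries each functional p |-> Phi p (x) to C(S), and [riesz_representation] turns it into a
    measure. *)

Lemma row_span_finite (F : fieldType) m (A : set 'rV[F]_m) :
  exists k (M : 'M[F]_(k, m)),
    (forall i, A (row i M)) /\ (forall v, A v -> (v <= M)%MS).
Proof.
(* A matrix with rows in [A] and maximal rank works: adjoining a member of [A] outside its row space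
   would raise the rank. *)
pose P (r : nat) := `[< exists k (M : 'M[F]_(k, m)),
  (forall i, A (row i M)) /\ \rank M = r >].
have exP : exists r, P r.
  exists 0%N; apply/asboolP; exists 0%N, 0; split; first by case.
  exact: mxrank0.
have ubP r : P r -> (r <= m)%N.
  by move=> /asboolP[k [M [_ <-]]]; exact: rank_leq_col.
case: (ex_maxnP exP ubP) => r /asboolP[k [M [MA rM]]] maxr.
exists k, M; split=> // v Av; apply/negPn/negP => vM.
have : P (\rank (col_mx M v)).
  apply/asboolP; exists (k + 1)%N, (col_mx M v); split=> // i.
  case: (split_ordP i) => j ->; first by rewrite rowKu.
  by rewrite rowKd ord1 (_ : row _ v = v)//; apply/rowP => l; rewrite mxE.
move=> /maxr; rewrite -rM leqNgt rank_ltmx//.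
rewrite /ltmx -addsmxE addsmxSl/=; apply: contra vM.
by rewrite col_mx_sub => /andP[].
Qed.

(** [finite_dim] asks for generators inside the set itself. So [A] is pulled back to coefficient
    vectors over the generators of [B], where finitely many members span it. *)
Lemma finite_dim_sub (R : realType) (V : lmodType R) (A B : set V) :
  finite_dim B -> A `<=` B -> A 0 ->
  (forall a u v, A u -> A v -> A (a *: u + v)) -> finite_dim A.
Proof.
move=> [m [b ->]] AB A0 Alin.
pose comb (v : 'rV[R]_m) := \sum_(i < m) v 0 i *: b i.
have [k [M [MA Mspan]]] := row_span_finite [set v | A (comb v)].
exists k, (fun j => comb (row j M)); apply/seteqP; split=> [v Av|v [c ->]].
  have [c vE] := AB _ Av.
  have := Mspan (\row_i c i); rewrite /comb /=.
  have -> : \sum_(i < m) (\row_i0 c i0) 0 i *: b i = v.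
    by rewrite vE; apply: eq_bigr => i _; rewrite mxE.
  move=> /(_ Av) /submxP[D cE]; exists (D 0).
  under eq_bigr do rewrite scaler_sumr.
  rewrite exchange_big vE; apply: eq_bigr => i _ /=.
  have -> : c i = (\row_i0 c i0) 0 i by rewrite mxE.
  rewrite cE mxE scaler_suml; apply: eq_bigr => j _.
  by rewrite scalerA mxE.
apply: (big_ind A) => // [u w Au Aw|i _].
  by rewrite -[u]scale1r; exact: Alin.
by rewrite -[_ *: _]addr0; apply: Alin => //; exact: MA.
Qed.

Section Evaluation.
Context {R : realType} {n : nat}.
Implicit Types (p q : mpoly n R) (x : 'rV[R]_n).

Lemma evalpD p q x : evalp (p + q) x = evalp p x + evalp q x.
Proof. exact: mevalD. Qed.

Lemma evalpB p q x : evalp (p - q) x = evalp p x - evalp q x.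
Proof. exact: mevalB. Qed.

Lemma evalpM p q x : evalp (p * q) x = evalp p x * evalp q x.
Proof. exact: mevalM. Qed.

Lemma evalpZ a p x : evalp (a *: p) x = a * evalp p x.
Proof. exact: mevalZ. Qed.

Lemma evalpC a x : evalp (mpolyC n a) x = a.
Proof. exact: mevalC. Qed.

Lemma evalpX i x : evalp (mpolyX R (mnm1 i)) x = x ord0 i.
Proof. exact: mevalXU. Qed.

Lemma evalp_sum I (r : seq I) P (F : I -> mpoly n R) x :
  evalp (\sum_(i <- r | P i) F i) x = \sum_(i <- r | P i) evalp (F i) x.
Proof. by rewrite /evalp raddf_sum. Qed.

Lemma restrp_inj (S : set 'rV[R]_n) : zariski_dense S -> injective (restrp S).
Proof.
move=> zS p q pq; apply/eqP; rewrite -subr_eq0; apply/negPn/negP => pq0.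
apply: zS; exists (p - q) => // x /mem_set Sx /=.
have /= := congr1 (fun f => f (exist _ x Sx)) pq.
by rewrite /restrp set_valE /= evalpB => ->; rewrite subrr.
Qed.

Lemma deg_le_span d : exists m (b : 'I_m -> mpoly n R),
  forall p, deg_le d p -> exists c : 'I_m -> R, p = \sum_i c i *: b i.
Proof.
pose T : finType := bmultinom n d.+1.
exists #|T|, (fun i => mpolyX R (bmnm (enum_val i : T))) => p dp.
exists (fun i => mcoeff (bmnm (enum_val i : T)) p).
rewrite {1}(mpolywE dp) (reindex (enum_val : 'I_#|T| -> T)); last first.
  by apply: onW_bij; exact: enum_val_bij.
by [].
Qed.

(** The nodes are points whose evaluation vectors (b_i(x))_i span all evaluation vectors of points
    of [S]. The coordinates of [ev s] over those of the nodes can be taken linear in [ev s], hence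
    polynomial in [s]. Zariski density turns the identity on [S] into one of polynomials. *)
Lemma interpolation (S : set 'rV[R]_n) m (b : 'I_m -> mpoly n R) :
  zariski_dense S -> exists k (x : 'I_k -> S) (c : 'I_k -> mpoly n R),
    (forall j, exists a : 'I_m -> R, c j = \sum_i a i *: b i) /\
    forall a : 'I_m -> R, let q := \sum_i a i *: b i in
      q = \sum_j restrp S q (x j) *: c j.
Proof.
move=> zS.
pose ev (s : S) : 'rV[R]_m := \row_i restrp S (b i) s.
have [k [M [MS Mspan]]] := row_span_finite (range ev).
have /choice[x xM] j : exists s, ev s = row j M.
  by have [s _ <-] := MS j; exists s.
(* At [s] this is entry j of [ev s *m pinvmx M], the coefficient of row j of [M] in [ev s]. *)
pose c j := \sum_i (pinvmx M) i j *: b i.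
exists k, x, c; split=> [j|a q]; first by exists (fun i => pinvmx M i j).
apply: (restrp_inj zS); apply/funext => s.
rewrite /restrp [RHS]evalp_sum.
have bE i : evalp (b i) (set_val s) =
    \sum_j evalp (c j) (set_val s) * evalp (b i) (set_val (x j)).
  have : (ev s <= M)%MS by apply: Mspan; exists s.
  move=> /mulmxKpV /(congr1 (fun v : 'rV_m => v 0 i)).
  rewrite !mxE [restrp _ _ _]/restrp => <-; apply: eq_bigr => j _.
  have /(congr1 (fun v : 'rV_m => v 0 i)) := xM j; rewrite !mxE => <-.
  congr (_ * _); rewrite /c evalp_sum; apply: eq_bigr => l _.
  by rewrite evalpZ mxE mulrC.
have evq y : evalp q y = \sum_i a i * evalp (b i) y.
  by rewrite evalp_sum; apply: eq_bigr => i _; rewrite evalpZ.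
rewrite evq; under eq_bigr do rewrite bE mulr_sumr.
rewrite exchange_big; apply: eq_bigr => j _ /=.
rewrite evalpZ evq mulr_suml; apply: eq_bigr => i _.
by rewrite [evalp (c j) _ * _]mulrC mulrA.
Qed.

End Evaluation.

(** * Stone-Weierstrass *)

(** Every iterate is a polynomial in [t], and the fixed points are the square roots of [t * t];
    started at 0, the iteration climbs to the absolute value on [-1, 1]. *)
Fixpoint abs_iter {R : realType} (k : nat) (t : R) : R :=
  if k is j.+1 then abs_iter j t + 2^-1 * (t * t - abs_iter j t * abs_iter j t)
  else 0.

(* The error e_k = |t| - abs_iter k t satisfies                              *)
(* e_(k+1) = e_k (1 - (|t| + abs_iter k t) / 2) <= e_k (1 - e_k / 2).        *)
Lemma abs_iter_bounds {R : realType} (k : nat) (t : R) : `|t| <= 1 ->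
  0 <= abs_iter k t /\ 0 <= `|t| - abs_iter k t <= 2 / k.+2%:R.
Proof.
move=> t1; elim: k => [|k [a0 /andP[e0 ek]]].
  by rewrite /= subr0 divff//; split=> //; rewrite normr_ge0 t1.
rewrite /=; move: a0 e0 ek; set a := abs_iter k t => a0 e0 ek.
have -> : t * t = `|t| * `|t| by rewrite -normrM ger0_norm// -expr2 sqr_ge0.
move: (normr_ge0 t) t1 e0 ek; move: `|t| => s s0 s1 e0 ek.
split; first by nra.
apply/andP; split; first by nra.
have kp : (0 : R) < k.+2%:R by rewrite ltr0n.
have {}ek : (s - a) * k.+2%:R <= 2 by rewrite -ler_pdivlMr.
rewrite ler_pdivlMr ?ltr0n// -[k.+3%:R]natr1.
have : (2 : R) <= k.+2%:R by rewrite ler_nat.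
move: ek kp; move: (k.+2%:R) => m ek m0 m2.
(* With m = k+2 and w = 2/m at most 1, monotonicity of e - e^2/2 on [0, 1] bounds the new error by w
   - w^2/2, and (w - w^2/2)(m+1) = 2 - w^2/2. *)
have [w wm] : exists w, w * m = 2 by exists (2 / m); rewrite divfK// gt_eqF.
have ew : s - a <= w by rewrite -(ler_pM2r m0) wm.
have w1 : w <= 1 by rewrite -(ler_pM2r m0) wm mul1r.
set f := s - _.
have fw : f <= w - w * w / 2 by rewrite /f; nra.
apply: le_trans (ler_wpM2r _ fw) _; first by lra.
have -> : (w - w * w / 2) * (m + 1) = w * m + w - (w * w + w * (w * m)) / 2.
  by field.
rewrite wm; nra.
Qed.

(** Compactness is used below in its near-covering form: what holds near every point, eventually
    along a filter, holds eventually on the whole space at once. *)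
Lemma compact_set_type (X : topologicalType) (A : set X) :
  compact A -> compact [set: A].
Proof.
move=> /compact_near_coveringP cA; apply/compact_near_coveringP => J F P FF cov.
have /cA H : forall x, A x -> \forall x' \near x & i \near F,
    forall h : x' \in A, P i (exist _ x' h).
  move=> x /mem_set Ax; have [[/= U1 U2] [U1x FU2] UP] := cov (exist _ x Ax) I.
  case: U1x => _ [/= [W oW <-] Wx] WU1.
  exists (W, U2); first by split=> //; exact: open_nbhs_nbhs.
  by move=> [y i] [/= Wy U2i] h; apply: (UP (exist _ y h, i)); split=> //;
    exact: WU1.
by apply: filterS H => i Pi [x h] _; exact: (Pi x (set_mem h)).
Qed.

Section StoneWeierstrass.
Context {R : realType} {n : nat} (S : set 'rV[R]_n).
Hypothesis cS : compact S.
Implicit Types (f g : S -> R) (p q : mpoly n R).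

Lemma continuous_setT_bounded f : continuous f ->
  exists2 M, 0 < M & forall x, `|f x| <= M.
Proof.
move=> cf; have /compact_near_coveringP := compact_set_type cS.
move=> /(_ R (pinfty_nbhs R) (fun M x => `|f x| <= M) _) H.
have {}H : \forall M \near +oo, [set: S] `<=` [set x | `|f x| <= M].
  apply: H => x _.
  exists ([set y | `|f x - f y| < 1], [set M | `|f x| + 1 < M]).
    split => /=; last by apply: nbhs_pinfty_gt; exact: num_real.
    by move/cvgrPdist_lt: (cf x) => /(_ 1 ltr01).
  move=> [y M] /= [fxy Mx]; have := ler_distD (f x) (f y) 0.
  by rewrite !subr0 distrC; lra.
have [M [MS M0]] := filter_ex (filterI H (nbhs_pinfty_gt (num_real 0))).
by exists M => // x; exact: MS.
Qed.

Definition approximable f := forall e, 0 < e ->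
  exists p, forall x, `|f x - restrp S p x| <= e.

Lemma approx_restrp p : approximable (restrp S p).
Proof. by move=> e e0; exists p => x; rewrite subrr normr0 ltW. Qed.

Lemma approxD f g : approximable f -> approximable g ->
  approximable (fun x => f x + g x).
Proof.
move=> af ag e e0; have e20 : 0 < e / 2 by rewrite divr_gt0.
have [p pf] := af _ e20; have [q qg] := ag _ e20.
exists (p + q) => x; rewrite /restrp evalpD opprD addrACA.
rewrite (le_trans (ler_normD _ _))// [e]splitr lerD//.
Qed.

Lemma approxZ a f : approximable f -> approximable (fun x => a * f x).
Proof.
move=> af e e0; have a0 : 0 < `|a| + 1 by rewrite ltr_wpDl.
have [p pf] := af _ (divr_gt0 e0 a0).
exists (a *: p) => x; rewrite /restrp evalpZ -mulrBr normrM.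
rewrite -(divfK (lt0r_neq0 a0) e) mulrC ler_pM// lerDl//.
Qed.

(** Scaling an approximating polynomial by its bound [M] brings its values on [S] into [-1, 1],
    where [abs_iter] converges uniformly. *)
Lemma approx_abs f : approximable f -> approximable (fun x => `|f x|).
Proof.
move=> af e e0; have e20 : 0 < e / 2 by rewrite divr_gt0.
have [p pf] := af _ e20.
have [M M0 pM] := continuous_setT_bounded (@restrp_continuous R n S p).
have [k kP] : exists k : nat, M * (2 / k.+2%:R) <= e / 2.
  exists (Num.trunc (4 * M / e)).
  have := Num.Theory.truncnS_gt (4 * M / e); move: (Num.trunc _) => k.
  rewrite ltr_pdivrMr// -[k.+2%:R]natr1 => H.
  rewrite mulrA ler_pdivrMr; last by rewrite ltr_wpDl.
  by nra.
pose fix Q j := if j is i.+1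
  then Q i + 2^-1 *: ((M^-1 *: p) * (M^-1 *: p) - Q i * Q i) else 0 : mpoly n R.
have QE j x : restrp S (Q j) x = abs_iter j (M^-1 * restrp S p x).
  elim: j => [|j]; first by rewrite /restrp /= /evalp raddf0.
  rewrite /restrp /= => IH.
  by rewrite evalpD evalpZ evalpB !evalpM !evalpZ IH.
exists (M *: Q k) => x.
rewrite {1}/restrp evalpZ -/(restrp _ _ _) QE.
have pM1 : `|M^-1 * restrp S p x| <= 1.
  by rewrite normrM gtr0_norm ?invr_gt0// ler_pdivrMl// mulr1.
have [_ /andP[e1 e2]] := abs_iter_bounds k pM1.
move: e1 e2; set a := abs_iter _ _;
  rewrite normrM gtr0_norm ?invr_gt0// => e1 e2.
have pE : `|restrp S p x| = M * (M^-1 * `|restrp S p x|).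
  by rewrite mulVKf ?gt_eqF.
rewrite -(subrKA `|restrp S p x|) (le_trans (ler_normD _ _))// [e]splitr lerD//.
  by rewrite (le_trans (ler_dist_dist _ _)).
rewrite pE -mulrBr normrM gtr0_norm// ger0_norm//.
by apply: le_trans kP; rewrite ler_pM2l.
Qed.

Lemma approx_max f g : approximable f -> approximable g ->
  approximable (fun x => Num.max (f x) (g x)).
Proof.
move=> af ag.
have -> : (fun x => Num.max (f x) (g x)) =
    (fun x => 2^-1 * (f x + g x + `|f x + -1 * g x|)).
  by apply/funext => x; rewrite maxr_absE mulrC mulN1r.
by apply/approxZ/approxD; [|apply: approx_abs]; apply: approxD => //;
  exact: approxZ.
Qed.

(** The norm of row vectors is the maximum norm, so the distance to [y] is a finite maximum of
    absolute values of affine polynomials. *)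
Lemma approx_dist (y : 'rV[R]_n) :
  approximable (fun x => `|set_val x - y|).
Proof.
have -> : (fun x : S => `|set_val x - y|) = (fun x =>
    \big[Num.max/0]_(i : 'I_1 * 'I_n) `|(set_val x - y) i.1 i.2|).
  by apply/funext => x; rewrite /Num.norm /= mx_normrE.
elim: (index_enum _) => [|i r IH].
  rewrite [X in approximable X](_ : _ = restrp S 0); first exact: approx_restrp.
  by apply/funext => x; rewrite big_nil /restrp /evalp raddf0.
rewrite [X in approximable X](_ : _ = fun x =>
  Num.max `|(set_val x - y) i.1 i.2|
  (\big[Num.max/0]_(j <- r) `|(set_val x - y) j.1 j.2|)); last first.
  by apply/funext => x; rewrite big_cons.
apply: approx_max => //; apply: approx_abs.
have -> : (fun x : S => (set_val x - y) i.1 i.2) =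
    restrp S (mpolyX R (mnm1 i.2) - mpolyC n (y 0 i.2)).
  apply/funext => x; rewrite /restrp evalpB evalpX evalpC !mxE.
  by rewrite !ord1.
exact: approx_restrp.
Qed.

(** Lattice argument: near each point, a steep downward cone stays below f + e/4 and is close to
    [f]. By compactness, a maximum of such cones is uniformly close to [f]. *)
Theorem stone_weierstrass f : continuous f -> approximable f.
Proof.
move=> cf e e0; have [M M0 fM] := continuous_setT_bounded cf.
have e40 : 0 < e / 4 by rewrite divr_gt0.
pose L := [set h : S -> R | approximable h /\ forall x, h x <= f x + e / 4].
(* [L] is directed upwards by maxima, so its upper sections generate a filter; near-covering along
   it replaces the choice of a finite subcover. *)
pose F := filter_from L (fun g => [set h | L h /\ forall x, g x <= h x]).
have FF : Filter F.
  apply: filter_from_filter.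
    exists (fun=> - M); split=> [|x].
      have -> : (fun=> - M) = restrp S (mpolyC n (- M));
        last exact: approx_restrp.
      by apply/funext => x; rewrite /restrp evalpC.
    by have := fM x; rewrite ler_norml => /andP[]; lra.
  move=> g1 g2 [a1 L1] [a2 L2]; exists (fun x => Num.max (g1 x) (g2 x)).
    by split=> [|x]; [exact: approx_max|rewrite ge_max L1 L2].
  by move=> h [Lh gh]; split; split=> // x;
    have := gh x; rewrite ge_max => /andP[].
have /compact_near_coveringP := compact_set_type cS.
move=> /(_ _ F (fun h x => f x - e / 2 <= h x) FF) H.
have [x _|g [ag Lg] gP] := H.
  have /cvgrPdist_lt/(_ _ e40) fx := cf x.
  case: (fx) => _ [/= [W oW <-] Wx] WU.
  have /nbhs_ballP[d /= d0 dW] : nbhs (set_val x) W by exact: open_nbhs_nbhs.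
  (* Within distance [d] of [x], [f] varies by less than e/4; beyond it, the cone has dropped by 2M,
     which suffices since [f] is bounded by [M]. *)
  pose K := 2 * M / d; pose g (y : S) := f x - K * `|set_val y - set_val x|.
  have K0 : 0 < K by rewrite divr_gt0 ?mulr_gt0.
  have gL : L g.
    split.
      have -> : g = fun y =>
          restrp S (mpolyC n (f x)) y + (- K) * `|set_val y - set_val x|.
        by apply/funext => y; rewrite /restrp evalpC mulNr.
      apply: approxD; first exact: approx_restrp.
      exact/approxZ/approx_dist.
    move=> y; have [yd|yd] := ltP `|set_val y - set_val x| d.
      have /WU /= : W (set_val y).
        by apply: dW; rewrite mx_norm_ball /= distrC.
      rewrite ltr_norml => /andP[_]; rewrite /g.
      have : 0 <= K * `|set_val y - set_val x| by rewrite mulr_ge0// ltW.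
      by lra.
    have := fM y; have := fM x; rewrite !ler_norml => /andP[_ ?] /andP[? _].
    suff : 2 * M <= K * `|set_val y - set_val x| by rewrite /g; lra.
    by rewrite /K mulrAC ler_pdivlMr// ler_pM2l// mulr_gt0.
  have Kd : 0 < e / 4 / K by rewrite divr_gt0.
  exists ([set y | `|f x - f y| < e / 4] `&`
      (set_val @^-1` ball (set_val x) (e / 4 / K)), [set h | L h /\ forall x,
        g x <= h x]).
    split; last by exists g.
    apply: filterI; first exact: fx.
    apply: initial_continuous; exact: nbhsx_ballx.
  move=> [y h] /= [[fxy]]; rewrite mx_norm_ball /= distrC ltr_pdivlMr// => yK.
  move=> [_ /(_ y)]; apply: le_trans.
  by move: fxy; rewrite ltr_norml => /andP[? ?]; rewrite /g; lra.
have [p gp] := ag _ e40; exists p => x.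
have := gP g; have := Lg x; have := gp x.
rewrite /= ler_norml => /andP[? ?] ? /(_ (conj (conj ag Lg) _)).
by move=> /(_ (fun=> lexx _) x Logic.I) ?; rewrite ler_norml; apply/andP;
  split; lra.
Qed.

End StoneWeierstrass.

(** * Extension of positive functionals from polynomials to C(S) *)

Section Extension.
Context {R : realType} {n : nat} (S : set 'rV[R]_n) (l : mpoly n R -> R).
Hypothesis l_linear : forall a p q, l (a *: p + q) = a * l p + l q.
Hypothesis l_ge0 : forall p, (forall x, 0 <= restrp S p x) -> 0 <= l p.
Implicit Types (f g : S -> R) (p q : mpoly n R).

(** Positivity bounds [l] by [l 1] times the sup-norm, so a polynomial within [e] of [f] fixes the
    value up to e l(1). The supremum of the resulting lower bounds avoids choosing an approximating
    sequence. *)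
Definition extension f : R :=
  sup [set y | exists p e, (forall x, `|f x - restrp S p x| <= e) /\
                           y = l p - e * l 1].

Lemma restrp1 x : restrp S 1 x = 1.
Proof. exact: meval1. Qed.

Let l1_ge0 : 0 <= l 1.
Proof. by apply: l_ge0 => x; rewrite restrp1. Qed.

Let l_le p q e : (forall x, restrp S p x <= restrp S q x + e) ->
  l p <= l q + e * l 1.
Proof.
move=> pq; have : 0 <= l (-1 *: p + (e *: 1 + q)).
  apply: l_ge0 => x; rewrite /restrp !(evalpD, evalpZ).
  by have := pq x; have := restrp1 x; rewrite /restrp => ->; lra.
by rewrite !l_linear; lra.
Qed.

Let approx_le f p q e e' : (forall x, `|f x - restrp S p x| <= e) ->
  (forall x, `|f x - restrp S q x| <= e') ->
  l p - e * l 1 <= l q + e' * l 1.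
Proof.
move=> fp fq; suff : l p <= l q + (e + e') * l 1 by lra.
apply: l_le => x; have := fp x; have := fq x.
by rewrite !ler_norml => /andP[? ?] /andP[? ?]; lra.
Qed.

Lemma extension_dist f p e : (forall x, `|f x - restrp S p x| <= e) ->
  `|l p - extension f| <= e * l 1.
Proof.
move=> fp; have ub : ubound [set y | exists p e,
    (forall x, `|f x - restrp S p x| <= e) /\ y = l p - e * l 1] (l p + e * l
      1).
  by move=> _ [q [e' [fq ->]]]; exact: approx_le fq fp.
have : extension f <= l p + e * l 1.
  by apply: ge_sup => //; exists (l p - e * l 1), p, e.
have : l p - e * l 1 <= extension f.
  by apply: ub_le_sup; [exists (l p + e * l 1)|exists p, e].
by move=> ? ?; rewrite ler_norml; apply/andP; split; lra.
Qed.

(** Reduces identities for [extension] to estimates on approximating polynomials; [C] absorbs the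
    constants. *)
Lemma extension_eq f v C : (forall e, 0 < e -> exists p,
    (forall x, `|f x - restrp S p x| <= e) /\ `|l p - v| <= e * C) ->
  extension f = v.
Proof.
move=> fv; apply/eqP; rewrite -subr_eq0 -normr_eq0 eq_le normr_ge0 andbT.
apply/ler_addgt0Pr => e e0; rewrite add0r.
have D0 : 0 < l 1 + `|C| + 1 by rewrite ltr_wpDl// addr_ge0.
have ed0 := divr_gt0 e0 D0.
have [p [fp pv]] := fv _ ed0; have := extension_dist fp.
rewrite distrC => fpe; rewrite -(subrKA (l p)).
rewrite (le_trans (ler_normD _ _))//.
apply: (@le_trans _ _ (e / (l 1 + `|C| + 1) * (l 1 + `|C| + 1))); last first.
  by rewrite divfK ?gt_eqF.
move: ed0 fpe pv; move: (e / _) => d d0 fpe pv.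
have : d * C <= d * `|C| by rewrite ler_pM2l// ler_norm.
by nra.
Qed.

Lemma extension_restrp p : extension (restrp S p) = l p.
Proof.
apply: (@extension_eq _ _ 0) => e e0; exists p.
by rewrite subrr mulr0 normr0; split=> // x; rewrite subrr normr0 ltW.
Qed.

Lemma extension_linear a f g : approximable f -> approximable g ->
  extension (fun x => a * f x + g x) = a * extension f + extension g.
Proof.
move=> af ag; apply: (@extension_eq _ _ (l 1)) => e e0.
have a0 : 0 < `|a| + 1 by rewrite ltr_wpDl.
have [p pf] := af _ (divr_gt0 e0 a0).
have [q qg] := ag _ (divr_gt0 e0 a0).
have eE : e = `|a| * (e / (`|a| + 1)) + e / (`|a| + 1).
  by rewrite -[LHS](divfK (lt0r_neq0 a0)) mulrDr mulr1 mulrC.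
exists (a *: p + q); split=> [x|].
  rewrite /restrp evalpD evalpZ opprD addrACA -mulrBr.
  rewrite (le_trans (ler_normD _ _))// [leRHS]eE normrM lerD//.
  by rewrite ler_wpM2l.
rewrite l_linear opprD addrACA -mulrBr.
rewrite (le_trans (ler_normD _ _))// [e in leRHS]eE mulrDl normrM -(mulrA `|a|).
apply: lerD; last exact: extension_dist.
by apply: ler_wpM2l => //; exact: extension_dist.
Qed.

Lemma extension_ge0 f : approximable f -> (forall x, 0 <= f x) ->
  0 <= extension f.
Proof.
move=> af f0; apply/ler_addgt0Pr => e e0.
have D0 : 0 < l 1 + l 1 + 1 by rewrite ltr_wpDl// addr_ge0.
have ed0 := divr_gt0 e0 D0.
have [p fp] := af _ ed0; have := extension_dist fp.
(* Raising [p] by its error makes it nonnegative on [S]. *)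
have : 0 <= l (e / (l 1 + l 1 + 1) *: 1 + p).
  apply: l_ge0 => x; have := fp x; have := f0 x; have := restrp1 x.
  by rewrite /restrp evalpD evalpZ ler_norml => -> ? /andP[? ?]; lra.
have : e / (l 1 + l 1 + 1) * (l 1 + l 1 + 1) = e by rewrite divfK// gt_eqF.
rewrite l_linear ler_norml; move: ed0; move: (e / _) => d d0 <- ? /andP[? ?].
by nra.
Qed.

End Extension.

(** * Open sets as positivity sets of continuous functions *)

Section Opens.
Context {R : realType} {n : nat}.
Implicit Types U : set 'rV[R]_n.

Lemma open_positivity_set U : open U -> exists u : 'rV[R]_n -> R,
  [/\ continuous u, forall x, 0 <= u x & forall x, U x <-> 0 < u x].
Proof.
move=> oU.
(* The infimum of [D x] is the distance to the complement of [U], cut off at 1; the element 1 keeps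
   [D x] nonempty when [U] is the whole space. It is 1-Lipschitz in [x]. *)
pose D (x : 'rV[R]_n) := [set r : R | r = 1 \/ exists2 y, ~ U y & r = `|x - y|].
pose u x := inf (D x).
have D1 x : D x !=set0 by exists 1; left.
have D0 x : lbound (D x) 0 by move=> _ [->//|[y _ ->]].
have u0 x : 0 <= u x by exact: lb_le_inf.
have u_le x r : D x r -> u x <= r by move=> Dr; apply: ge_inf => //; exists 0.
have lip x y : u x <= u y + `|x - y|.
  rewrite -lerBlDr; apply: lb_le_inf => // _ [->|[z Uz ->]]; rewrite lerBlDr.
    by apply: (@le_trans _ _ 1); [apply: u_le; left|rewrite lerDl].
  apply: (@le_trans _ _ `|x - z|); first by apply: u_le; right; exists z.
  by rewrite [leRHS]addrC; exact: ler_distD.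
exists u; split=> // [x|x].
  apply/(@cvgrPdist_lt _ _ _ (nbhs x)) => e e0.
  apply/nbhs_ballP; exists e => // y.
  rewrite mx_norm_ball /= => xy; apply: le_lt_trans xy.
  have := lip x y; have := lip y x; rewrite (distrC y) ler_norml => ? ?.
  by apply/andP; split; lra.
split=> [Ux|ux].
  have /nbhs_ballP[d /= d0 dU] : nbhs x U by exact: open_nbhs_nbhs.
  apply: (@lt_le_trans _ _ (Num.min 1 d)); first by rewrite lt_min ltr01 d0.
  apply: lb_le_inf => // _ [->|[y Uy ->]]; first by rewrite ge_min lexx.
  rewrite ge_min; apply/orP; right; rewrite leNgt; apply/negP => xy; apply: Uy.
  by apply: dU; rewrite mx_norm_ball.
apply: contrapT => Ux; move: ux; apply/negP; rewrite -leNgt.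
by apply: u_le; right; exists x => //; rewrite subrr normr0.
Qed.

End Opens.

(** * Borel sets and integrals on a compact set *)

Section BorelIntegral.
Context {R : realType} {n : nat} (S : set 'rV[R]_n).
Hypothesis cS : compact S.
Implicit Types (U : set 'rV[R]_n) (f : 'rV[R]_n -> R)
  (m : {measure set (@borel_space R n) -> \bar R}).

Lemma open_borel U : open U -> measurable (U : set (@borel_space R n)).
Proof. exact: sub_sigma_algebra. Qed.

Lemma compact_closed_rV : closed S.
Proof. by apply: compact_closed => //; exact: norm_hausdorff. Qed.

Lemma compact_borel : measurable (S : set (@borel_space R n)).
Proof.
rewrite -[S]setCK; apply: measurableC; apply: open_borel.
exact/closed_openC/compact_closed_rV.
Qed.

Lemma measure_off (m : {measure set (@borel_space R n) -> \bar R})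
    (A : set (@borel_space R n)) :
  m (~` S) = 0%E -> measurable A -> m A = m (A `&` S).
Proof.
move=> m0 mA; have mS := compact_borel.
apply/eqP; rewrite eq_le; apply/andP; split; last first.
  by apply: le_measure; rewrite ?inE//; exact: measurableI.
rewrite -[leRHS]adde0 -m0; apply: le_trans (measureU2 _ _ _); last 2 first.
- exact: measurableI.
- exact: measurableC.
apply: le_measure; rewrite ?inE//.
  by apply: measurableU; [exact: measurableI|exact: measurableC].
by move=> x Ax; have [Sx|Sx] := pselect (S x); [left|right].
Qed.

Lemma continuous_borel (D : set (@borel_space R n)) f : continuous f ->
  measurable_fun D (f : @borel_space R n -> R).
Proof.
move=> cf; apply: measurable_funTS.
apply: (measurability _ (RGenOpens.measurableE R)).
move=> _ [_ [a [b ->] <-]]; rewrite setTI; apply: open_borel.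
by move/continuousP : cf; apply; exact: interval_open.
Qed.

Lemma continuous_comp_val f : continuous f ->
  continuous (fun x : S => f (set_val x)).
Proof.
by move=> cf x; apply: continuous_comp; [exact: initial_continuous|exact: cf].
Qed.

Lemma continuous_borel_integrable m f : (m S < +oo)%E -> continuous f ->
  m.-integrable S (EFin \o (f : @borel_space R n -> R)).
Proof.
move=> mS cf; apply: measurable_bounded_integrable => //.
- exact: compact_borel.
- exact: continuous_borel.
have [M M0 fM] := continuous_setT_bounded cS (continuous_comp_val cf).
exists M; split; first exact: num_real.
move=> N MN x Sx; apply: le_trans (ltW MN).
by have := fM (exist _ x (mem_set Sx)); rewrite set_valE.
Qed.

End BorelIntegral.

(** * Riesz representation *)

Section Riesz.
Context {R : realType} {n : nat} (S : set 'rV[R]_n) (L : (S -> R) -> R).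
Hypothesis cS : compact S.
Hypothesis L_linear : forall a (f g : S -> R), continuous f -> continuous g ->
  L (fun x => a * f x + g x) = a * L f + L g.
Hypothesis L_ge0 : forall f : S -> R, continuous f -> (forall x,
  0 <= f x) -> 0 <= L f.
Implicit Types (f g : S -> R) (U V : set 'rV[R]_n).

Let ccst (a : R) : continuous (fun _ : S => a).
Proof. by move=> x; exact: cst_continuous. Qed.

Let cD f g : continuous f -> continuous g -> continuous (fun x => f x + g x).
Proof. by move=> cf cg x; apply: continuousD; [exact: cf|exact: cg]. Qed.

Let cZ a f : continuous f -> continuous (fun x => a * f x).
Proof.
by move=> cf x; apply: (@continuousM _ _ (fun=> a)); [exact: ccst|exact: cf].
Qed.

Let cmin f g : continuous f -> continuous g ->
  continuous (fun x => Num.min (f x) (g x)).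
Proof. by move=> cf cg x; apply: continuous_min; [exact: cf|exact: cg]. Qed.

Let cmax f g : continuous f -> continuous g ->
  continuous (fun x => Num.max (f x) (g x)).
Proof. by move=> cf cg x; apply: continuous_max; [exact: cf|exact: cg]. Qed.

Let csum (F : nat -> S -> R) m : (forall i, continuous (F i)) ->
  continuous (fun x => \sum_(i < m) F i x).
Proof.
move=> cF; elim: m => [|m IH].
  rewrite [X in continuous X](_ : _ = fun=> 0) ?funeqE => [|x];
    first exact: ccst.
  by rewrite big_ord0.
rewrite [X in continuous X](_ : _ = fun x =>
  \sum_(i < m) F i x + F m x) ?funeqE.
  exact: cD.
by move=> x; rewrite big_ord_recr.
Qed.

Let L0 : L (fun=> 0) = 0.
Proof.
have := L_linear 1 (@ccst 0) (@ccst 0).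
rewrite [X in L X](_ : _ = fun=> 0) ?funeqE => [|x];
  last by rewrite mulr0 addr0.
by lra.
Qed.

Let LD f g : continuous f -> continuous g ->
  L (fun x => f x + g x) = L f + L g.
Proof.
move=> cf cg; have := L_linear 1 cf cg.
by rewrite mul1r [X in L X](_ : _ = fun x => f x + g x) ?funeqE// => x;
  rewrite mul1r.
Qed.

Let LZ a f : continuous f -> L (fun x => a * f x) = a * L f.
Proof.
move=> cf; have := L_linear a cf (@ccst 0); rewrite L0 addr0 => <-.
by congr L; apply/funext => x; rewrite addr0.
Qed.

Let Lsum (F : nat -> S -> R) m : (forall i, continuous (F i)) ->
  L (fun x => \sum_(i < m) F i x) = \sum_(i < m) L (F i).
Proof.
move=> cF; elim: m => [|m IH].
  by rewrite big_ord0 -L0; congr L; apply/funext => x; rewrite big_ord0.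
rewrite big_ord_recr /= -IH -LD//; last exact: csum.
by congr L; apply/funext => x; rewrite big_ord_recr.
Qed.

Let L_le f g : continuous f -> continuous g -> (forall x, f x <= g x) ->
  L f <= L g.
Proof.
move=> cf cg fg; have := L_linear (-1) cf cg => H.
suff : 0 <= L (fun x => -1 * f x + g x) by rewrite H; lra.
apply: L_ge0; first by apply: cD => //; exact: cZ.
by move=> x; have := fg x; lra.
Qed.

Let L1 := L (fun=> 1).

Let L1_ge0 : 0 <= L1. Proof. exact: L_ge0. Qed.

Let Lcst a : L (fun=> a) = a * L1.
Proof. by rewrite -LZ//; congr L; apply/funext => x; rewrite mulr1. Qed.

(** These are the continuous functions between 0 and the indicator of [U]. The supremum [lam U] of
    [L] over them will be the measure of an open [U]. *)
Let adm U f := [/\ continuous f, forall x, 0 <= f x <= 1 &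
  forall x, ~ U (set_val x) -> f x = 0].

Let lam U : \bar R := ereal_sup [set (L f)%:E | f in adm U].

Let adm0 U : adm U (fun=> 0).
Proof. by split=> // x; rewrite lexx ler01. Qed.

Let le_lam U f : adm U f -> ((L f)%:E <= lam U)%E.
Proof. by move=> Uf; apply: ereal_sup_ubound; exists f. Qed.

Let lam_ge0 U : (0 <= lam U)%E.
Proof. by have := le_lam (adm0 U); rewrite L0. Qed.

Let lam_leL1 U : (lam U <= L1%:E)%E.
Proof.
apply: ge_ereal_sup => _ [f [cf f01 _] <-]; rewrite lee_fin; apply: L_le => //.
by move=> x; have /andP[] := f01 x.
Qed.

Let lam_mono U V : U `<=` V -> (lam U <= lam V)%E.
Proof.
move=> UV; apply: ge_ereal_sup => _ [f [cf f01 fU] <-]; apply: le_lam.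
by split=> // x Vx; apply: fU => /UV.
Qed.

Let lam_fin U : lam U \is a fin_num.
Proof. by rewrite ge0_fin_numE// (le_lt_trans (lam_leL1 U))// ltry. Qed.

Let lam_off U : (forall x : S, ~ U (set_val x)) -> lam U = 0%E.
Proof.
move=> US; apply/eqP; rewrite eq_le lam_ge0 andbT.
apply: ge_ereal_sup => _ [f [cf f01 fU] <-].
by rewrite (_ : f = fun=> 0) ?L0//; apply/funext => x; rewrite fU.
Qed.

(** With u_i positive exactly on F_i, the functions min(1, N u_i) are admissible for F_i.
    Compactness gives one [N] for which the sum of the first [N] of them dominates f - d on all of
    [S]. *)
Let lam_sigma_subadditive (F : nat -> set 'rV[R]_n) : (forall i, open (F i)) ->
  (lam (\bigcup_i F i) <= \sum_(i <oo) lam (F i))%E.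
Proof.
move=> oF; have /choice[u uP] i := open_positivity_set (oF i).
apply: ge_ereal_sup => _ [f [cf f01 fU] <-].
apply/lee_addgt0Pr => e e0.
have D0 : 0 < L1 + 1 by rewrite ltr_wpDl.
pose d := e / (L1 + 1); have d0 : 0 < d by rewrite divr_gt0.
pose G N i (x : S) := Num.min 1 (N%:R * u i (set_val x)).
have cG N i : continuous (G N i).
  by apply: cmin => //; apply/cZ/continuous_comp_val; case: (uP i).
have G0 N i x : 0 <= G N i x.
  by rewrite le_min ler01 mulr_ge0//; case: (uP i).
have /compact_near_coveringP := compact_set_type cS.
move=> /(_ _ \oo (fun N x => f x - d <= \sum_(i < N) G N i x) _) H.
have [x _|N _ /(_ N (leqnn _)) NP] := H.
  have [fx|fx] := ltP (f x) d.
    exists ([set y | f y < d], setT).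
      by split; [exact: (cvgr_lt _ (cf x))|exact: filterT].
    move=> [y N] /= [fy _]; apply: (@le_trans _ _ 0);
      first by rewrite lerBlDr add0r ltW.
    exact: sumr_ge0.
  have [i _ Fix] : (\bigcup_i F i) (set_val x).
    apply: contrapT => /fU fx0; move: fx; rewrite fx0; apply/negP.
    by rewrite -ltNge.
  have [cu u0 uF] := uP i; have ux := (uF _).1 Fix.
  have nu : \forall y \near x, u i (set_val x) / 2 < u i (set_val y).
    have cux : {for x, continuous (fun y : S => u i (set_val y))}.
      exact: continuous_comp_val.
    by apply: (cvgr_gt _ cux); rewrite ltr_pdivrMr// ltr_pMr// ltr1n.
  exists ([set y | u i (set_val x) / 2 < u i (set_val y)],
          [set N | (i < N)%N /\ 2 / u i (set_val x) <= N%:R]).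
    split=> /=; first exact: nu.
    exists (maxn i.+1 (Num.trunc (2 / u i (set_val x))).+1) => // N /=.
    rewrite geq_max => /andP[? ?]; split=> //.
    apply: le_trans (ltW (Num.Theory.truncnS_gt _)) _.
    by rewrite ler_nat.
  move=> [y N] /= [uy [iN]]; rewrite ler_pdivrMr// => Nu.
  rewrite (bigD1 (Ordinal iN))//= ler_wpDr//; first exact: sumr_ge0.
  have -> : G N i y = 1.
    by apply/min_idPl; have : (0 : R) <= N%:R by []; nra.
  by have /andP[_] := f01 y; lra.
apply: (@le_trans _ _ (\sum_(i < N) lam (F i) + e%:E)%E); last first.
  rewrite leeD2r//; rewrite -(big_mkord xpredT (fun i => lam (F i))).
  exact: nneseries_lim_ge.
have LG i : ((L (G N i))%:E <= lam (F i))%E.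
  have [cu u0 uF] := uP i; apply: le_lam; split=> // x.
    by rewrite G0 ge_min lexx.
  move=> Fx; rewrite /G; suff -> : u i (set_val x) = 0 by rewrite mulr0 min_r.
  apply/eqP; rewrite eq_le u0 andbT leNgt; apply/negP => /uF; exact: Fx.
apply: (@le_trans _ _ (\sum_(i < N) (L (G N i))%:E + e%:E)%E); last first.
  by rewrite leeD2r// lee_sum.
rewrite sumEFin -EFinD lee_fin.
have -> : e = d * L1 + d by rewrite -(divfK (lt0r_neq0 D0) e) mulrDr mulr1.
rewrite -Lsum// -Lcst.
apply: (@le_trans _ _ (L (fun x => \sum_(i < N) G N i x + d))).
  apply: L_le => //; first by apply: cD => //; exact: csum.
  by move=> x; rewrite -lerBlDr; exact: NP.
rewrite LD//; last exact: csum.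
by rewrite lerD2l lerDl ltW.
Qed.

(** The outer measure obtained from [lam] by outer regularity. *)
Let mus (A : set 'rV[R]_n) : \bar R :=
  ereal_inf [set lam U | U in [set U | open U /\ A `<=` U]].

Let mus_open U : open U -> mus U = lam U.
Proof.
move=> oU; apply/eqP; rewrite eq_le; apply/andP; split.
  by apply: ge_ereal_inf; exists (lam U) => //; exists U => //; split.
by apply: le_ereal_inf_tmp => _ [V [_ UV] <-]; exact: lam_mono.
Qed.

Let mus_ge0 A : (0 <= mus A)%E.
Proof. by apply: le_ereal_inf_tmp => _ [V _ <-]. Qed.

Let mus_le_lam A U : open U -> A `<=` U -> (mus A <= lam U)%E.
Proof. by move=> oU AU; apply: ge_ereal_inf; exists (lam U) => //;
  exists U. Qed.

Let mus_mono : {homo mus : A B / A `<=` B >-> (A <= B)%E}.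
Proof.
move=> A B AB; apply: le_ereal_inf_tmp => _ [V [oV BV] <-].
by apply: mus_le_lam => //; exact: subset_trans BV.
Qed.

Let mus_fin A : mus A \is a fin_num.
Proof.
rewrite ge0_fin_numE//; apply: (@le_lt_trans _ _ (lam setT)).
  by apply: mus_le_lam => //; exact: openT.
by rewrite -ge0_fin_numE.
Qed.

Let mus0 : mus set0 = 0%E.
Proof. by rewrite mus_open; [apply: lam_off => x []|exact: open0]. Qed.

Let mus_sigma_subadditive : sigma_subadditive mus.
Proof.
move=> F; apply/lee_addgt0Pr => e e0.
have e20 i : 0 < e / (2 ^ i.+1)%:R by rewrite divr_gt0// ltr0n expn_gt0.
have /choice[U UP] i : exists U, [/\ open U, F i `<=` U &
    (lam U <= mus (F i) + (e / (2 ^ i.+1)%:R)%:E)%E].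
  have [_ [U [oU FU] <-] /ltW] := lb_ereal_inf_adherent (e20 i) (mus_fin (F i)).
  by exists U.
apply: le_trans (epsilon_trick xpredT (fun i => mus_ge0 (F i)) (ltW e0)).
apply: (@le_trans _ _ (lam (\bigcup_i U i))).
  apply: mus_le_lam; first by apply: bigcup_open => i _; case: (UP i).
  by apply: subset_bigcup => i _; case: (UP i).
apply: le_trans (lam_sigma_subadditive _) _; first by move=> i; case: (UP i).
by apply: lee_nneseries => // i _; case: (UP i).
Qed.

Let mus_outer : {outer_measure set 'rV[R]_n -> \bar R}.
Proof.
pose M := isOuterMeasure.Build R 'rV[R]_n mus mus0 mus_ge0 mus_mono
  mus_sigma_subadditive.
exact: (HB.pack mus M).
Defined.

(** Let [f] be admissible for the intersection of [V] and [U]. The part of [V] where f < d is a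
    neighbourhood of [V] minus [U]; any [g] admissible for it can be added to max(f - d, 0) without
    leaving the functions admissible for [V]. *)
Let lam_caratheodory U V : open U -> open V ->
  (lam (V `&` U) + mus (V `&` ~` U) <= lam V)%E.
Proof.
move=> oU oV; rewrite -leeBrDr//; apply: ge_ereal_sup => _ [f [cf f01 fUV] <-].
rewrite leeBrDr//; apply/lee_addgt0Pr => e e0.
have D0 : 0 < L1 + 1 by rewrite ltr_wpDl.
pose d := e / (L1 + 1); have d0 : 0 < d by rewrite divr_gt0.
have [Q oQ QE] : exists2 Q, open Q & set_val @^-1` Q = [set x | f x < d].
  have /continuousP/(_ [set y | y < d]) := cf.
  have od : open [set y : R | y < d] by exact: open_lt.
  by move=> /(_ od) [Q oQ QE]; exists Q.
(* [Q] controls [f] only on [S]; adding the complement of [S] makes [W] cover the points of [V]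
   minus [U] outside [S] as well. *)
pose W := V `&` (Q `|` ~` S).
have oW : open W by apply: openI => //; apply: openU => //;
  exact: closed_openC (compact_closed_rV cS).
have VW : V `&` ~` U `<=` W.
  move=> x [Vx Ux]; split=> //; have [Sx|] := pselect (S x); last by right.
  left; have := congr1 (fun A => A (exist _ x (mem_set Sx))) QE.
  rewrite /preimage /= set_valE /= => ->.
  by rewrite fUV// => -[_].
apply: (@le_trans _ _ ((L f)%:E + lam W)%E).
  by rewrite leeD2l//; exact: mus_le_lam.
rewrite addeC -leeBrDr//; apply: ge_ereal_sup => _ [g [cg g01 gW] <-].
rewrite leeBrDr//.
(* At each point at most one summand is nonzero: [g] vanishes where f >= d. *)
pose h x := Num.max (f x - d) 0 + g x.
have cfd : continuous (fun x => f x - d) by exact: cD.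
have cm : continuous (fun x => Num.max (f x - d) 0) by exact: cmax.
have hV : adm V h.
  split=> [|x|x Vx]; first exact: cD.
    have /andP[f0 f1] := f01 x; have /andP[g0 g1] := g01 x.
    have [fd|fd] := leP (f x) d.
      by rewrite /h max_r ?add0r ?g0// subr_le0.
    rewrite /h gW ?addr0.
      by rewrite le_max lexx orbT /= ge_max ler01 andbT; lra.
    move=> [_ [Qx|]]; last by apply; exact: set_valP.
    have : (set_val @^-1` Q) x by [].
    by rewrite QE /= ltNge ltW.
  rewrite /h gW; last by move=> [].
  rewrite fUV; last by move=> [].
  by rewrite sub0r addr0 max_r// oppr_le0 ltW.
apply: le_trans (leeD2r _ (le_lam hV)).
rewrite -!EFinD lee_fin /h LD//.
have : L f - d * L1 <= L (fun x => Num.max (f x - d) 0).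
  have -> : L f - d * L1 = L (fun x => f x - d) by rewrite LD// Lcst mulNr.
  by apply: L_le => // x; rewrite le_max lexx.
have : e = d * (L1 + 1) by rewrite divfK// gt_eqF.
by nra.
Qed.

Let open_caratheodory U : open U -> caratheodory_measurable mus U.
Proof.
move=> oU; apply: (@le_caratheodory_measurable _ _ mus_outer) => X.
apply: le_ereal_inf_tmp => _ [V [oV XV] <-].
apply: le_trans (lam_caratheodory oU oV); apply: leeD.
  by apply: mus_le_lam; [exact: openI|exact: setSI].
by apply: mus_mono; exact: setSI.
Qed.

Let borel_caratheodory (A : set (@borel_space R n)) :
  measurable A -> (measurable : set (set (caratheodory_type mus_outer))) A.
Proof.
apply: smallest_sub; first exact: sigma_algebra_measurable.
by move=> U oU; exact: open_caratheodory.
Qed.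

Let mus_sigma_additive :
  semi_sigma_additive (mus : set (@borel_space R n) -> \bar R).
Proof.
move=> F mF tF mUF.
apply: (@caratheodory_measure_sigma_additive _ _ mus_outer) => //.
- by move=> i; exact: borel_caratheodory.
- exact: borel_caratheodory.
Qed.

Let mu : {measure set (@borel_space R n) -> \bar R}.
Proof.
pose M := isMeasure.Build _ (@borel_space R n) R mus mus0 mus_ge0
  mus_sigma_additive.
exact: (HB.pack mus M).
Defined.


Let mu_open U : open U -> mu U = lam U.
Proof. exact: mus_open. Qed.

Let muSC : mu (~` S) = 0%E.
Proof.
rewrite mu_open; last exact: closed_openC (compact_closed_rV cS).
by apply: lam_off => x; apply; exact: set_valP.
Qed.

Let muT : (mu setT <= L1%:E)%E.
Proof. by rewrite mu_open; [exact: lam_leL1|exact: openT]. Qed.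

Let muS_fin : (mu S < +oo)%E.
Proof.
apply: (@le_lt_trans _ _ (mu setT)); last exact: le_lt_trans muT (ltry _).
by apply: le_measure; rewrite ?inE//; exact: compact_borel.
Qed.

(* With F_k = min(f, (k+1)d) - min(f, kd), f is the sum of the F_k and each   *)
(* F_k / d is admissible for the open set {f > kd}.                           *)
Let L_le_integral (f : 'rV[R]_n -> R) : continuous f ->
  (forall x, S x -> 0 <= f x) ->
  ((L (fun x => f (set_val x)))%:E <= \int[mu]_(x in S) (f x)%:E)%E.
Proof.
move=> cf f0; have mS := compact_borel cS.
apply/lee_addgt0Pr => e e0.
have D0 : 0 < L1 + 1 by rewrite ltr_wpDl.
pose d := e / (L1 + 1); have d0 : 0 < d by rewrite divr_gt0.
have cfS := continuous_comp_val cf (S := S).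
have [M M0 fM] := continuous_setT_bounded cS cfS.
(* Enough layers of height [d] to exceed the bound [M] of [f]. *)
pose m := (Num.trunc (M / d)).+1.
have mM : M <= m%:R * d.
  by rewrite -ler_pdivrMr// ltW// Num.Theory.truncnS_gt.
pose A k : set (@borel_space R n) := [set x | k%:R * d < f x].
have oA k : open (A k).
  by move/continuousP : cf => /(_ [set y | k%:R * d < y]); apply;
    exact: open_gt.
have mA k : measurable (A k) by exact: open_borel.
pose C k (x : S) := Num.min (f (set_val x)) (k%:R * d).
pose F k (x : S) := C k.+1 x + -1 * C k x.
have cC k : continuous (C k) by exact: cmin.
have cF k : continuous (F k) by apply: cD => //; exact: cZ.
have admF k : adm (A k) (fun x => d^-1 * F k x).
  have kS : k.+1%:R * d = k%:R * d + d by rewrite -natr1 mulrDl mul1r.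
  split=> [|x|x /negP]; first exact: cZ.
    apply/andP; split.
      rewrite mulr_ge0 ?invr_ge0 ?(ltW d0)// /F /C kS.
      by case: (leP (f _) (k%:R * d)); case: (leP (f _) (_ + d)); lra.
    rewrite ler_pdivrMl// mulr1 /F /C kS.
    by case: (leP (f _) (k%:R * d)); case: (leP (f _) (_ + d)); lra.
  rewrite -leNgt => fk; rewrite /F /C kS !min_l//;
    first by rewrite mulN1r subrr mulr0.
  by rewrite (le_trans fk)// lerDl ltW.
have LE : L (fun x => f (set_val x)) = d * \sum_(k < m) L (fun x =>
  d^-1 * F k x).
  rewrite -(@Lsum (fun k x => d^-1 * F k x)); last by move=> k; exact: cZ.
  rewrite -LZ; last first.
    by apply: (@csum (fun k x => d^-1 * F k x)) => k; exact: cZ.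
  congr L; apply/funext => x; rewrite -mulr_sumr mulVKf ?gt_eqF//.
  rewrite -(big_mkord xpredT (fun k => F k x)) /F.
  under eq_bigr do rewrite mulN1r.
  rewrite (telescope_sumr (fun k => C k x))// /C mul0r min_l.
    rewrite min_r ?subr0//; apply: f0; exact: set_valP.
  by apply: le_trans mM; apply: le_trans (fM x); exact: ler_norm.
have muA k : ((L (fun x => d^-1 * F k x))%:E <= mu (A k `&` S))%E.
  by rewrite -(measure_off cS muSC (mA k)) mu_open//; exact: le_lam.
have step : (\int[mu]_(x in S) (d%:E * \sum_(k < m) (\1_(A k) x)%:E) <=
    \int[mu]_(x in S) ((f x)%:E + d%:E))%E.
  apply: ge0_le_integral => //.
  - by move=> x _; apply: mule_ge0; [rewrite lee_fin ltW|apply: sume_ge0].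
  - apply: emeasurable_funM => //; apply: emeasurable_sum => k.
    by apply/measurable_EFinP; exact: measurable_indic.
  - apply: emeasurable_funD => //; apply/measurable_EFinP.
    exact: continuous_borel.
  move=> x Sx; rewrite sumEFin -EFinM -EFinD lee_fin.
  (* The second bound drives the induction: if [x] lies in [A i], then i d < f(x), so one more layer
     stays below f(x) + d. *)
  suff : forall i, d * \sum_(k < i) \1_(A k) x <= f x + d /\
    d * \sum_(k < i) \1_(A k) x <= i%:R * d by move=> /(_ m) [].
  elim=> [|i [IH1 IH2]].
    by rewrite big_ord0 mulr0 mul0r lexx addr_ge0 ?f0// ltW.
  rewrite big_ord_recr /= mulrDr -natr1 mulrDl mul1r indicE.
  have [/set_mem|_] := boolP (x \in A i).
    by rewrite /A /= mulr1 => xA; split; lra.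
  by rewrite mulr0; split; lra.
rewrite LE.
apply: (@le_trans _ _ (\int[mu]_(x in S) (d%:E * \sum_(k < m) (\1_(A k)
  x)%:E))%E).
  rewrite ge0_integralZl_EFin//; last 3 first.
  - by move=> x _; apply: sume_ge0.
  - apply: emeasurable_sum => k.
    by apply/measurable_EFinP; exact: measurable_indic.
  - exact: ltW.
  rewrite EFinM lee_pmul2l//.
  rewrite ge0_integral_sum//; last first.
    move=> k; apply/measurable_EFinP; exact: measurable_indic.
  rewrite -sumEFin; apply: lee_sum => k _.
  by rewrite integral_indic.
apply: (le_trans step).
rewrite ge0_integralD//; last 2 first.
- by apply/measurable_EFinP; exact: continuous_borel.
- by move=> x _; rewrite lee_fin ltW.
rewrite leeD2l// integral_cst//.
apply: (@le_trans _ _ (d%:E * L1%:E)%E).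
  rewrite lee_pmul2l ?lte_fin//; apply: le_trans muT.
  by apply: le_measure; rewrite ?inE.
rewrite -EFinM lee_fin; have : e = d * (L1 + 1) by rewrite divfK// gt_eqF.
by nra.
Qed.

(** Adding a constant K extends the inequality L f <= I f from nonnegative to all continuous [f],
    because mu(S) <= L(1). Applying it to -f gives equality. *)
Theorem riesz_representation :
  exists m : {measure set (@borel_space R n) -> \bar R},
    m (~` S) = 0%E /\ forall f : 'rV[R]_n -> R, continuous f ->
      (\int[m]_(x in S) (f x)%:E)%E = (L (fun x => f (set_val x)))%:E.
Proof.
exists mu; split=> // f cf; have mS := compact_borel cS.
pose I (g : 'rV[R]_n -> R) : R := \int[mu]_(x in S) g x.
have Ifin (g : 'rV[R]_n -> R) :
  continuous g -> (I g)%:E = (\int[mu]_(x in S) (g x)%:E)%E.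
  move=> cg; rewrite /I /Rintegral fineK//; apply: integrable_fin_num => //.
  exact: continuous_borel_integrable.
have IM a (g : 'rV[R]_n -> R) : continuous g -> I (fun x => a * g x) = a * I g.
  by move=> cg; apply: RintegralZl => //; exact: continuous_borel_integrable.
have ccstV (a : R) : continuous (fun _ : 'rV[R]_n => a).
  by move=> x; exact: cst_continuous.
have cZV a (g : 'rV[R]_n -> R) : continuous g -> continuous (fun x :
  'rV[R]_n => a * g x).
  move=> cg x; apply: (@continuousM _ _ (fun=> a)); last exact: cg.
  exact: ccstV.
have LI (g : 'rV[R]_n -> R) : continuous g -> L (fun x => g (set_val x)) <= I g.
  move=> cg; have cgS := continuous_comp_val cg (S := S).
  have [K K0 gK] := continuous_setT_bounded cS cgS.
  have cgK : continuous (fun x => g x + K).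
    by move=> x; apply: continuousD; [exact: cg|exact: ccstV].
  have : L (fun x => g (set_val x) + K) <= I (fun x => g x + K).
    rewrite -lee_fin Ifin//; apply: (L_le_integral cgK) => x Sx.
    have := gK (exist _ x (mem_set Sx)); rewrite set_valE /= ler_norml.
    by move=> /andP[? _]; lra.
  rewrite LD// Lcst /I RintegralD//; last 2 first.
  - exact: continuous_borel_integrable.
  - by apply: continuous_borel_integrable => //; exact: ccstV.
  have : fine (mu S) <= L1.
    rewrite -lee_fin fineK; last by rewrite ge0_fin_numE.
    by apply: le_trans muT; apply: le_measure; rewrite ?inE.
  by rewrite Rintegral_cst//; nra.
rewrite -Ifin//; congr EFin; apply/eqP; rewrite eq_le LI// andbT.
have := LI _ (cZV (-1) _ cf); rewrite IM// LZ; first by lra.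
exact: continuous_comp_val.
Qed.

End Riesz.

(** * Signed combinations of measures *)

Section SignedSums.
Context {R : realType} {n : nat} (S : set 'rV[R]_n).
Hypothesis cS : compact S.
Local Notation measureV := {measure set (@borel_space R n) -> \bar R}.
Variables (m : nat -> measureV) (N : nat) (a : nat -> R).
Hypothesis m_off : forall k, m k (~` S) = 0%E.
Hypothesis m_fin : forall k, (m k S < +oo)%E.
Implicit Types (f g : 'rV[R]_n -> R) (A U : set (@borel_space R n)).

Let mS : measurable (S : set (@borel_space R n)).
Proof. exact: compact_borel. Qed.

Let m_finA k A : measurable A -> m k A \is a fin_num.
Proof.
move=> mA; rewrite ge0_fin_numE// (measure_off cS)//;
  apply: le_lt_trans (m_fin k).
by apply: le_measure; rewrite ?inE//; exact: measurableI.
Qed.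

(** Measures allow only nonnegative weights, so the vanishing of a signed combination is expressed
    as the equality of [mix pos] and [mix neg]. *)
Let mix (b : nat -> {nonneg R}) : measureV :=
  msum (fun k => mscale (b k) (m k)) N.

Let mixE b A : measurable A ->
  mix b A = (\sum_(k < N) (b k)%:num * fine (m k A))%:E.
Proof.
move=> mA; rewrite /mix /= /msum -sumEFin; apply: eq_bigr => k _.
by rewrite /mscale EFinM fineK// m_finA.
Qed.

Let mix_integral b f : continuous f -> (forall x, S x -> 0 <= f x) ->
  (\int[mix b]_(x in S) (f x)%:E =
   (\sum_(k < N) (b k)%:num * \int[m k]_(x in S) f x)%:E)%E.
Proof.
move=> cf f0; have mf : measurable_fun (S : set (@borel_space R n))
    (fun x : @borel_space R n => (f x)%:E).
  by apply/measurable_EFinP; exact: continuous_borel.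
rewrite ge0_integral_measure_sum// -sumEFin; apply: eq_bigr => k _.
rewrite ge0_integral_mscale// EFinM; congr (_ * _)%E.
rewrite /Rintegral fineK//; apply: integrable_fin_num => //.
exact: continuous_borel_integrable.
Qed.

Let max0_ge0 (x : R) :
  0 <= Num.max x 0. Proof. by rewrite le_max lexx orbT. Qed.

Let pos k : {nonneg R} := NngNum (max0_ge0 (a k)).

Let neg k : {nonneg R} := NngNum (max0_ge0 (- a k)).

Let split_sum (X : nat -> R) : \sum_(k < N) a k * X k =
  \sum_(k < N) (pos k)%:num * X k - \sum_(k < N) (neg k)%:num * X k.
Proof.
rewrite -sumrB; apply: eq_bigr => k _; rewrite -mulrBl; congr (_ * _) => /=.
by case: (leP (a k) 0); case: (leP (- a k) 0); lra.
Qed.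

Let integral_eq0_ge0 f : continuous f -> (forall x, S x -> 0 <= f x) ->
  \sum_(k < N) a k * \int[m k]_(x in S) f x = 0 <->
  (\int[mix pos]_(x in S) (f x)%:E = \int[mix neg]_(x in S) (f x)%:E)%E.
Proof.
move=> cf f0; rewrite (split_sum (fun k =>
  \int[m k]_(x in S) f x)) !mix_integral//.
split=> [/eqP|[->]]; last by rewrite subrr.
by rewrite subr_eq0 => /eqP ->.
Qed.

Let measure_eq0 A : measurable A ->
  \sum_(k < N) a k * fine (m k A) = 0 <-> mix pos A = mix neg A.
Proof.
move=> mA; rewrite (split_sum (fun k => fine (m k A))) !mixE//.
split=> [/eqP|[->]]; last by rewrite subrr.
by rewrite subr_eq0 => /eqP ->.
Qed.

(** The two mixtures agree on Borel subsets of [S], hence on integrals of nonnegative functions; a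
    constant shift covers the other continuous functions. *)
Lemma sum_integral_eq0 : (forall A, measurable A -> A `<=` S ->
    \sum_(k < N) a k * fine (m k A) = 0) ->
  forall f, continuous f -> \sum_(k < N) a k * \int[m k]_(x in S) f x = 0.
Proof.
move=> mA f cf.
have main g : continuous g -> (forall x, S x -> 0 <= g x) ->
    \sum_(k < N) a k * \int[m k]_(x in S) g x = 0.
  move=> cg g0; apply/integral_eq0_ge0 => //; apply: eq_measure_integral.
  by move=> A mbA AS; apply/measure_eq0 => //; exact: mA.
have [K K0 fK] := continuous_setT_bounded cS (continuous_comp_val cf (S := S)).
have cK : continuous (fun _ : 'rV[R]_n => K) by move=> x; exact: cst_continuous.
have cfK : continuous (fun x => f x + K).
  by move=> x; apply: continuousD; [exact: cf|exact: cK].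
have : \sum_(k < N) a k * \int[m k]_(x in S) (f x + K) = 0.
  apply: main => // x Sx; have := fK (exist _ x (mem_set Sx)).
  by rewrite set_valE /= ler_norml => /andP[]; lra.
under eq_bigr do (rewrite RintegralD// ?mulrDr;
  [|exact: continuous_borel_integrable..]).
rewrite big_split /= (main (fun=> K))// ?addr0// => x _; exact: ltW.
Qed.

(** Uniqueness of representing measures. Stone-Weierstrass passes from polynomials to continuous
    functions, the increasing functions min(1, j u) pass to open sets, and these form a generating
    class closed under intersection. *)
Lemma sum_measure_eq0 : (forall p : mpoly n R,
    \sum_(k < N) a k * \int[m k]_(x in S) evalp p x = 0) ->
  forall A, measurable A -> \sum_(k < N) a k * fine (m k A) = 0.
Proof.
move=> mp.
have mc f : continuous f -> \sum_(k < N) a k * \int[m k]_(x in S) f x = 0.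
  move=> cf; apply/eqP; rewrite -normr_eq0 eq_le normr_ge0 andbT.
  apply/ler_addgt0Pr => e e0; rewrite add0r.
  (* Replacing [f] by a polynomial within [d] changes the combination by at most d C. *)
  pose C := \sum_(k < N) `|a k| * fine (m k S).
  have C0 : 0 <= C by apply: sumr_ge0 => k _; rewrite mulr_ge0// fine_ge0.
  have D0 : 0 < C + 1 by rewrite ltr_wpDl.
  pose d := e / (C + 1); have d0 : 0 < d by rewrite divr_gt0.
  have [p pf] := stone_weierstrass cS (continuous_comp_val cf (S := S)) d0.
  have cp := @evalp_continuous R n p.
  apply: (@le_trans _ _ (\sum_(k < N) `|a k| * (d * fine (m k S)))); last first.
    have -> : e = d * (C + 1) by rewrite divfK// gt_eqF.
    under eq_bigr do rewrite mulrCA.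
    by rewrite -mulr_sumr -/C ler_pM2l// lerDl.
  have -> : \sum_(k < N) a k * \int[m k]_(x in S) f x =
      \sum_(k < N) (a k * \int[m k]_(x in S) f x -
                     a k * \int[m k]_(x in S) evalp p x).
    by rewrite sumrB mp subr0.
  apply: le_trans (ler_norm_sum _ _ _) _; apply: ler_sum => k _.
  rewrite -mulrBr normrM ler_wpM2l// -RintegralB//;
    try exact: continuous_borel_integrable.
  have cfp : continuous (fun x => f x - evalp p x).
    by move=> x; apply: continuousB; [exact: cf|exact: cp].
  apply: le_trans (le_normr_Rintegral _ _) _ => //.
    exact: continuous_borel_integrable.
  rewrite -Rintegral_cst//; apply: le_Rintegral => //.
  - apply: continuous_borel_integrable => // x.
    apply: (@continuous_comp _ _ _ (fun x => f x - evalp p x) Num.norm).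
      exact: cfp.
    exact: norm_continuous.
  - by apply: continuous_borel_integrable => // x; exact: cst_continuous.
  - by move=> x Sx; have := pf (exist _ x (mem_set Sx));
      rewrite /restrp set_valE.
have mU U : open (U : set 'rV[R]_n) -> mix pos U = mix neg U.
  move=> oU; have [u [cu u0 uU]] := open_positivity_set oU.
  have mbU := open_borel oU.
  have mixU b : mix b U = mix b (U `&` S).
    apply: (measure_off cS) => //; rewrite /mix /= /msum big1// => k _.
    exact: etrans (congr1 (mule _) (m_off k)) (mule0 _).
  pose f j (x : @borel_space R n) := Num.min 1 (j%:R * u x).
  have cf j : continuous (f j : 'rV[R]_n -> R).
    move=> x; apply: (@continuous_min _ _ (fun=> 1) (fun x => j%:R * u x)).
      exact: cst_continuous.
    by apply: (@continuousM _ _ (fun=> j%:R));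
      [exact: cst_continuous|exact: cu].
  have f0 j x : 0 <= f j x by rewrite le_min ler01 mulr_ge0.
  have cvg_mix b : (\int[mix b]_(x in S) (f j x)%:E @[j --> \oo] --> mix b U)%E.
    rewrite mixU -integral_indic//.
    rewrite [X in _ --> X](_ : _ =
      (\int[mix b]_(x in S) limn (fun j => (f j x)%:E))%E).
      apply: cvg_monotone_convergence => //.
      - move=> j; apply/measurable_EFinP.
        exact: continuous_borel.
      - by move=> j x _; rewrite lee_fin.
      - move=> x _ i j ij; rewrite lee_fin /f.
        by rewrite le_min ge_min lexx ge_min ler_wpM2r ?orbT// ler_nat.
    apply: eq_integral => x _; apply/esym/cvg_lim => //.
    apply: cvg_EFin; first by apply: nearW.
    rewrite indicE; have [/set_mem Ux|Ux] := boolP (x \in U).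
      apply: cvg_near_cst; have ux := (uU x).1 Ux.
      exists (Num.trunc (u x)^-1).+1 => // j /= ij.
      rewrite /f min_l// -ler_pdivrMr// div1r.
      by apply: le_trans (ltW (Num.Theory.truncnS_gt _)) _; rewrite ler_nat.
    apply: cvg_near_cst; apply: nearW => j; rewrite /f /=.
    have -> : u x = 0.
      apply/eqP; rewrite eq_le u0 andbT leNgt; apply/negP => /uU /mem_set.
      by apply/negP.
    by rewrite mulr0 min_r.
  rewrite -(cvg_lim _ (cvg_mix pos))// -(cvg_lim _ (cvg_mix neg))//.
  congr (limn _); apply/funext => j; apply/integral_eq0_ge0 => //.
  exact: mc.
move=> A mA; apply/measure_eq0 => //.
apply: (@measure_unique _ R (@borel_space R n) (@open 'rV[R]_n) (fun=> setT)
  _ _ _ _ (mix pos) (mix neg)) => //.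
- by move=> U V; exact: openI.
- by move=> _; exact: openT.
- by rewrite bigcup_const.
- by move=> _; rewrite mixE// ltry.
Qed.

End SignedSums.

(** * Nonnegativity preservers *)

Lemma the_suchP (T : Type) (x0 : T) (P : set T) :
  (exists x, P x) -> P (the_such x0 P).
Proof. by move=> exP; rewrite /the_such; case: pselect => // e;
  exact: svalP. Qed.

(** * The space C(S) and its sup-norm *)

Section ContS.
Context {R : realType} {n : nat} (S : set 'rV[R]_n).
Hypothesis cS : compact S.
Implicit Types (f g : contS S) (p q : mpoly n R).

Lemma val_contSD f g x : val (f + g) x = val f x + val g x.
Proof. by []. Qed.

Lemma val_contSB f g x : val (f - g) x = val f x - val g x.
Proof. by []. Qed.

Lemma val_contSZ a f x : val (a *: f) x = a * val f x.
Proof. by []. Qed.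

Lemma val_contS_sum m (F : 'I_m -> contS S) x :
  val (\sum_i F i) x = \sum_i val (F i) x.
Proof.
elim: m F => [|m IH] F; first by rewrite !big_ord0.
by rewrite !big_ord_recl val_contSD IH.
Qed.

Lemma contS_continuous f : continuous (val f).
Proof. by apply/asboolP; exact: (valP f). Qed.

Lemma polyS_linear a p q : polyS S (a *: p + q) = a *: polyS S p + polyS S q.
Proof.
by apply: val_inj; apply/funext => x; rewrite val_contSD val_contSZ /= /restrp
  evalpD evalpZ.
Qed.

Lemma polyS_sum m (a : 'I_m -> R) (F : 'I_m -> mpoly n R) :
  polyS S (\sum_i a i *: F i) = \sum_i a i *: polyS S (F i).
Proof.
apply: val_inj; apply/funext => x; rewrite val_contS_sum /= /restrp evalp_sum.
by apply: eq_bigr => i _; rewrite evalpZ.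
Qed.

Lemma le_supnorm f x : `|val f x| <= supnorm f.
Proof.
have [M _ fM] := continuous_setT_bounded cS (@contS_continuous f).
by apply: ub_le_sup; [exists M => _ [y _ <-]|exists x].
Qed.

Lemma supnorm_le f M : 0 <= M -> (forall x, `|val f x| <= M) -> supnorm f <= M.
Proof.
move=> M0 fM; rewrite /supnorm.
(* If [S] is empty, the supremum is that of the empty set, which is 0. *)
have [->|/set0P ne] := eqVneq (range (fun x : S => `|val f x|)) set0.
  by rewrite sup0.
by apply: ge_sup => // _ [x _ <-].
Qed.

End ContS.

(** * Representing measures, the extension, and the equivalences *)

Section Preserver.
Context {R : realType} {n : nat} (S : set 'rV[R]_n).
Variable Phi : {linear mpoly n R -> mpoly n R}.
Hypotheses (cS : compact S) (zS : zariski_dense S).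
Hypothesis Phi_ge0 : nonneg_preserver S Phi.
Implicit Types (p q : mpoly n R) (x y s : S).

Let at_ x p := restrp S (Phi p) x.

Let at_linear x a p q : at_ x (a *: p + q) = a * at_ x p + at_ x q.
Proof. by rewrite /at_ linearP /restrp evalpD evalpZ. Qed.

Let at_ge0 x p : (forall y, 0 <= restrp S p y) -> 0 <= at_ x p.
Proof.
move=> p0; apply: Phi_ge0; last exact: set_valP.
by move=> y Sy; have := p0 (exist _ y (mem_set Sy)); rewrite /restrp set_valE.
Qed.

(** Evaluation of [Phi p] at [x] is a positive functional of [p]; its extension to C(S) is positive
    and linear, so the Riesz theorem applies. *)
Lemma repr_measureP x : represents S Phi x (repr_measure S Phi x).
Proof.
have [||mu [mu0 muE]] := @riesz_representation R n S (extension (at_ x)) cS.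
- move=> a f g cf cg; apply: extension_linear => //; first exact: at_ge0.
  + exact: stone_weierstrass.
  + exact: stone_weierstrass.
- move=> f cf; apply: extension_ge0 => //; last exact: stone_weierstrass.
  exact: at_ge0.
apply: the_suchP; exists mu; split=> // p.
rewrite muE; last exact: evalp_continuous.
by rewrite (extension_restrp (at_linear x) (@at_ge0 x)).
Qed.

Lemma repr_measure_fin x : (repr_measure S Phi x S < +oo)%E.
Proof.
have [_ /(_ 1)] := repr_measureP x.
under eq_integral do rewrite [evalp 1 _]meval1.
by rewrite integral_cst ?mul1e//; [move=> <-;
  rewrite ltry|exact: compact_borel].
Qed.

Lemma repr_measure_integral x p :
  \int[repr_measure S Phi x]_(y in S) evalp p y = restrp S (Phi p) x.
Proof. by have [_ /(_ p)] := repr_measureP x; rewrite /Rintegral => <-. Qed.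

Lemma Phistar_interpolation k (x : 'I_k -> S) (c : 'I_k -> mpoly n R) s :
  (forall A : set (@borel_space R n), measurable A -> A `<=` S ->
    Phistar S Phi A s = \sum_j restrp S (c j) s * Phistar S Phi A (x j)) <->
  (forall p,
    restrp S (Phi p) s = \sum_j restrp S (c j) s * restrp S (Phi p) (x j)).
Proof.
(* Index 0 carries [s] with weight 1, index j+1 carries [x j] with weight -c_j(s). The defaults of
   [oapp] lie beyond the k+1 terms summed. *)
pose pt i := if i is j.+1 then oapp x s (insub j) else s.
pose m i := repr_measure S Phi (pt i).
pose a i := if i is j.+1 then oapp (fun j => - restrp S (c j) s) 0 (insub j)
  else 1.
have sumE (F : S -> R) (G : nat -> R) :
    (forall i, G i = F (pt i)) ->
    \sum_(i < k.+1) a i * G i = 0 <->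
    F s = \sum_j restrp S (c j) s * F (x j).
  move=> GE; rewrite big_ord_recl /= mul1r GE.
  have -> : \sum_(i < k) a (bump 0 i) * G (bump 0 i) =
      - \sum_j restrp S (c j) s * F (x j).
    by rewrite -sumrN; apply: eq_bigr => j _; rewrite GE /= valK /= mulNr.
  by split=> [/eqP|->]; rewrite ?subrr// subr_eq0 => /eqP.
have m_off i : m i (~` S) = 0%E by case: (repr_measureP (pt i)).
have m_fin i : (m i S < +oo)%E by exact: (repr_measure_fin (pt i)).
have intE p : \sum_(i < k.+1) a i * \int[m i]_(y in S) evalp p y = 0 <->
    restrp S (Phi p) s = \sum_j restrp S (c j) s * restrp S (Phi p) (x j).
  exact: (sumE (restrp S (Phi p)) (fun i => \int[m i]_(y in S) evalp p y)
    (fun i => repr_measure_integral (pt i) p)).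
have measE A : \sum_(i < k.+1) a i * fine (m i A) = 0 <->
    Phistar S Phi A s = \sum_j restrp S (c j) s * Phistar S Phi A (x j).
  exact: (sumE (Phistar S Phi A) (fun i => fine (m i A)) (fun=> erefl)).
split=> [H p|H A mA AS].
  apply/intE; apply: (sum_integral_eq0 cS m_off m_fin).
    by move=> A mA AS; apply/measE; exact: H.
  exact: evalp_continuous.
apply/measE; apply: (sum_measure_eq0 cS m_off m_fin) => // p.
exact/intE.
Qed.

Let Phi1_bound : exists2 M, 0 < M & forall x, `|at_ x 1| <= M.
Proof. exact: (continuous_setT_bounded cS (@restrp_continuous R n S (Phi 1))).
  Qed.

Let ext_dist x f p e : (forall y, `|f y - restrp S p y| <= e) ->
  `|at_ x p - extension (at_ x) f| <= e * at_ x 1.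
Proof. exact: (extension_dist (at_linear x) (@at_ge0 x)). Qed.

(** The function is a uniform limit of polynomials [Phi p] on [S], since the errors are controlled
    by the bound [M] of [Phi 1]. *)
Let ext_continuous (f : contS S) :
  continuous (fun x => extension (at_ x) (val f)).
Proof.
have [M M0 PM] := Phi1_bound.
move=> x; apply/(@cvgrPdist_lt _ _ _ (nbhs x)) => e e0.
have e30 : 0 < e / 3 by rewrite divr_gt0.
have [p fp] := stone_weierstrass cS (@contS_continuous _ _ _ f) (divr_gt0 e30
  M0).
have near_p y : `|at_ y p - extension (at_ y) (val f)| <= e / 3.
  apply: le_trans (ext_dist y fp) _.
  rewrite -[leRHS](divfK (lt0r_neq0 M0)) ler_pM2l ?divr_gt0//.
  exact: le_trans (ler_norm _) (PM y).
have /cvgrPdist_lt/(_ _ e30) near_x := @restrp_continuous R n S (Phi p) x.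
apply: (filterS _ near_x) => y; rewrite -/(at_ x p) -/(at_ y p) => xy.
have := near_p x; have := near_p y; move: xy.
rewrite ltr_norml !ler_norml => /andP[? ?] /andP[? ?] /andP[? ?].
by rewrite ltr_norml; apply/andP; split; lra.
Qed.

Lemma extend_to_contSP : let T := extend_to_contS S Phi in
  [/\ linear T, supnorm_continuous T & forall p,
    T (polyS S p) = polyS S (Phi p)].
Proof.
apply: (@the_suchP _ (fun=> 0) [set T : contS S -> contS S | [/\ linear T,
  supnorm_continuous T &
  forall p, T (polyS S p) = polyS S (Phi p)]]).
have [M M0 PM] := Phi1_bound.
pose T (f : contS S) : contS S :=
  exist _ (fun x => extension (at_ x) (val f)) (asboolT (@ext_continuous f)).
have appr (f : contS S) : approximable (val f).
  by apply: stone_weierstrass => //; exact: contS_continuous.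
have Tlin : linear T.
  move=> a f g; apply: val_inj; apply/funext => x /=.
  exact: (extension_linear (at_linear x) (@at_ge0 x) a (appr f) (appr g)).
exists T; split=> // [f e e0|p].
  have e20 : 0 < e / 2 by rewrite divr_gt0.
  exists (e / 2 / M) => [|g fg]; first by rewrite divr_gt0.
  apply: (@le_lt_trans _ _ (e / 2)); last by rewrite gtr_pMr// invf_lt1// ltr1n.
  apply: supnorm_le => [|x]; first exact: ltW.
  have -> : T g - T f = T (g - f).
    by have := Tlin (-1) f g; rewrite !scaleN1r [g - f]addrC => ->;
      rewrite addrC.
  (* The zero polynomial approximates g - f within e/(2M), so [ext_dist] bounds T(g - f). *)
  have H0 y : `|val (g - f) y - restrp S 0 y| <= e / 2 / M.
    rewrite {1}/restrp /evalp raddf0 subr0.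
    exact: le_trans (le_supnorm cS _ _) (ltW fg).
  have := ext_dist x H0.
  rewrite {1}/at_ raddf0 /restrp /evalp raddf0 sub0r normrN.
  move=> /le_trans; apply.
  rewrite -[leRHS](divfK (lt0r_neq0 M0)) ler_pM2l ?divr_gt0//.
  exact: le_trans (ler_norm _) (PM x).
apply: val_inj; apply/funext => x /=.
exact: (extension_restrp (at_linear x) (@at_ge0 x)).
Qed.

(** That each [c j] lies in the range of [Phi] is what later puts it in the range of the
    extension. *)
Lemma finite_dim_reproducing : finite_dim (range Phi) ->
  exists k (x : 'I_k -> S) (c : 'I_k -> mpoly n R),
    (forall j, range Phi (c j)) /\
    forall p, Phi p = \sum_j restrp S (Phi p) (x j) *: c j.
Proof.
move=> [m [b rE]]; have [k [x [c [cb cE]]]] := interpolation b zS.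
exists k, x, c; split=> [j|p]; first by rewrite rE; have [a ->] := cb j;
  exists a.
have : range Phi (Phi p) by exists p.
by rewrite {1}rE => -[a ->]; exact: cE.
Qed.

Lemma finite_dim_range_sub k (c : 'I_k -> mpoly n R) :
  (forall p, exists a : 'I_k -> R, Phi p = \sum_j a j *: c j) ->
  finite_dim (range Phi).
Proof.
move=> H; apply: (@finite_dim_sub _ _ _
    [set v | exists a : 'I_k -> R, v = \sum_j a j *: c j]).
- by exists k, c.
- by move=> _ [p _ <-].
- by exists 0; rewrite // raddf0.
- by move=> a _ _ [p _ <-] [q _ <-]; exists (a *: p + q); rewrite // linearP.
Qed.

(** Interpolation in degree at most [d] reproduces every [Phistar S Phi A] from its values at the
    nodes; transferred to [Phi p], it exhibits [Phi p] as a combination of the [c j]. *)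
Lemma Phistar_finite_dim :
  (exists d : nat, forall A : set (@borel_space R n),
    measurable A -> A `<=` S ->
    exists2 q : mpoly n R, deg_le d q & Phistar S Phi A = restrp S q) ->
  finite_dim (range Phi).
Proof.
move=> [d Hd]; have [m [b bE]] := @deg_le_span R n d.
have [k [x [c [_ cE]]]] := interpolation b zS.
apply: (@finite_dim_range_sub k c) => p;
  exists (fun j => restrp S (Phi p) (x j)).
apply: (restrp_inj zS); apply/funext => s; rewrite {2}/restrp evalp_sum.
rewrite ((Phistar_interpolation x c s).1 _ p).
  by apply: eq_bigr => j _; rewrite evalpZ mulrC.
move=> A mA AS; have [q dq ->] := Hd A mA AS.
have [a qE] := bE q dq; rewrite {1}qE cE -qE {1}/restrp evalp_sum.
by apply: eq_bigr => j _; rewrite evalpZ mulrC.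
Qed.

Lemma finite_dim_Phistar : finite_dim (range Phi) ->
  exists d : nat, forall A : set (@borel_space R n),
    measurable A -> A `<=` S ->
    exists2 q : mpoly n R, deg_le d q & Phistar S Phi A = restrp S q.
Proof.
move=> /finite_dim_reproducing[k [x [c [_ cE]]]].
(* [mmeasure mdeg] is one more than the degree of a nonzero polynomial, so this bound leaves slack,
   taken up by [leqW]. *)
exists (\max_j mmeasure mdeg (c j))%N => A mA AS.
exists (\sum_j Phistar S Phi A (x j) *: c j).
  apply: leq_trans (mmeasure_sum _ _ _ _) _; apply/bigmax_leqP => j _.
  apply: leq_trans (mmeasureZ_le _ _ _) _; apply: leqW.
  exact: (leq_bigmax (F := fun j => mmeasure mdeg (c j))).
apply/funext => s; rewrite /restrp evalp_sum.
rewrite ((Phistar_interpolation x c s).2 _ A mA AS).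
  by apply: eq_bigr => j _; rewrite evalpZ mulrC.
move=> p; rewrite {1}cE {1}/restrp evalp_sum.
by apply: eq_bigr => j _; rewrite evalpZ mulrC.
Qed.

Lemma finite_dim_extend : finite_dim (range Phi) ->
  finite_dim (range (extend_to_contS S Phi)).
Proof.
move=> /finite_dim_reproducing[k [x [c [cr cE]]]].
have [_ Tcont Tpoly] := extend_to_contSP;
  set T := extend_to_contS S Phi in Tcont Tpoly *.
exists k, (fun j => polyS S (c j)); apply/seteqP; split=> [_ [f _ <-]|_ [a ->]].
  exists (fun j => val (T f) (x j)).
  apply: val_inj; apply/funext => s; rewrite val_contS_sum.
  apply/eqP; rewrite -subr_eq0 -normr_eq0 eq_le normr_ge0 andbT.
  apply/ler_addgt0Pr => e e0; rewrite add0r.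
  (* An error [d] at [s] and at every node contributes at most d(1 + C) = e to the reproducing
     formula. *)
  pose C := \sum_j `|restrp S (c j) s|.
  have C0 : 0 <= C by exact: sumr_ge0.
  have D0 : 0 < 1 + C by rewrite ltr_wpDr.
  pose d := e / (1 + C); have d0 : 0 < d by rewrite divr_gt0.
  have [h h0 hT] := Tcont f d d0.
  have h20 : 0 < h / 2 by rewrite divr_gt0.
  have [p fp] := stone_weierstrass cS (@contS_continuous _ _ _ f) h20.
  have TPhi y : `|restrp S (Phi p) y - val (T f) y| <= d.
    have /hT : supnorm (polyS S p - f) < h.
      apply: (@le_lt_trans _ _ (h / 2));
        last by rewrite gtr_pMr// invf_lt1// ltr1n.
      apply: supnorm_le => [|z]; first exact: ltW.
      by rewrite val_contSB distrC; exact: fp.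
    rewrite Tpoly => /ltW; apply: le_trans.
    by have := le_supnorm cS (polyS S (Phi p) - T f) y; rewrite val_contSB.
  have -> : val (T f) s - \sum_j val (val (T f) (x j) *: polyS S (c j)) s =
      (val (T f) s - restrp S (Phi p) s) +
      \sum_j (restrp S (Phi p) (x j) - val (T f) (x j)) * restrp S (c j) s.
    have -> : restrp S (Phi p) s =
        \sum_j restrp S (Phi p) (x j) * restrp S (c j) s.
      rewrite {1}cE {1}/restrp evalp_sum.
      by apply: eq_bigr => j _; rewrite evalpZ.
    rewrite -addrA; congr (_ + _); rewrite -!sumrN -big_split /=.
    by apply: eq_bigr => j _; rewrite mulrBl addKr.
  rewrite (le_trans (ler_normD _ _))//.
  have -> : e = d + \sum_j d * `|restrp S (c j) s|.
    by rewrite -mulr_sumr -/C -[X in X + _]mulr1 -mulrDr divfK// gt_eqF.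
  rewrite lerD//; first by rewrite distrC.
  apply: le_trans (ler_norm_sum _ _ _) _; apply: ler_sum => j _.
  by rewrite normrM ler_wpM2r.
(* For the reverse inclusion, the combinations of the [c j] are images under [Phi] of polynomials,
   which the extension maps in the same way. *)
have /choice[p pc] j : exists p, Phi p = c j by have [p _ <-] := cr j; exists p.
exists (polyS S (\sum_j a j *: p j)) => //.
rewrite Tpoly linear_sum -polyS_sum; congr polyS.
by apply: eq_bigr => j _; rewrite linearZ pc.
Qed.

(** The functions [polyS S (Phi p)] form a subspace of the range of the extension, and relations
    among them lift to polynomials because [restrp S] is injective. *)
Lemma extend_finite_dim : finite_dim (range (extend_to_contS S Phi)) ->
  finite_dim (range Phi).
Proof.
have [_ _ Tpoly] := extend_to_contSP => fT.
have : finite_dim (range (polyS S \o Phi)).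
  apply: finite_dim_sub fT _ _ _.
  - by move=> _ [p _ <-]; exists (polyS S p) => //; rewrite Tpoly.
  - exists 0 => //=; apply: val_inj; apply/funext => x.
    by rewrite /= raddf0 /restrp /evalp raddf0.
  - move=> a _ _ [p _ <-] [q _ <-]; exists (a *: p + q) => //=.
    by rewrite linearP polyS_linear.
move=> [m [b bE]].
have /choice[p pb] i : exists p, polyS S (Phi p) = b i.
  have : range (polyS S \o Phi) (b i).
    rewrite bE; exists (fun j => (j == i)%:R).
    rewrite (bigD1 i)//= eqxx scale1r big1 ?addr0// => j /negPf ->.
    by rewrite scale0r.
  by move=> [p _ <-]; exists p.
apply: (@finite_dim_range_sub m (Phi \o p)) => q.
have : range (polyS S \o Phi) (polyS S (Phi q)) by exists q.
rewrite bE => -[a qE]; exists a; apply: (restrp_inj zS).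
have : polyS S (Phi q) = polyS S (\sum_i a i *: (Phi \o p) i).
  by rewrite polyS_sum qE; apply: eq_bigr => i _; rewrite /= pb.
by move=> /(congr1 val).
Qed.

End Preserver.

Theorem theorem6p4 (R : realType) (n : nat) (S : set 'rV[R]_n)
    (Phi : {linear mpoly n R -> mpoly n R}) :
  compact S -> zariski_dense S -> nonneg_preserver S Phi ->
  let cond_i := exists d : nat, forall A : set (@borel_space R n),
    measurable A -> A `<=` S ->
    exists2 q : mpoly n R, deg_le d q & Phistar S Phi A = restrp S q in
  let cond_ii := finite_dim (range Phi) in
  let cond_iii := finite_dim (range (extend_to_contS S Phi)) in
  (cond_i <-> cond_ii) /\ (cond_ii <-> cond_iii).
Proof.
move=> cS zS Phi_ge0; split; split.
- exact: Phistar_finite_dim.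
- exact: finite_dim_Phistar.
- exact: finite_dim_extend.
- exact: extend_finite_dim.
Qed.
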